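(* Consider the single-queue bandit and the algorithm Q-ThS described in the context, with any problem instance $(\lambda,\boldsymbol\mu)$. Let $$w(t)=\exp\left(\left(\frac{2\log t}{\Delta}\right)^{2/3}\right),\quad v'(t)=\frac{6K}{\epsilon}w(t),\quad v(t)=\frac{24}{\epsilon^2}\log t+\frac{60K}{\epsilon}\frac{v'(t)\log^2 t}{t}.$$ Then there exist constants $C>0$ and $t_0$, not depending on $K$ or $\epsilon$, such that under Q-ThS $$\Psi(t)\le C\,\frac{K\,v(t)\log^2 t}{t}$$ for all $t>t_0$ satisfying $\frac{w(t)}{\log t}\ge\frac{2}{\epsilon}$, $t\ge\exp(6/\Delta^2)$ and $v(t)+v'(t)\le t/2$.
   Context: Discrete-time queueing system with one queue and $K\ge 2$ servers indexed by $[K]$. Arrivals $A(t)\in\{0,1\}$ are i.i.d. Bernoulli($\lambda$); the service $R_k(t)\in\{0,1\}$ of server $k$ at time $t$ is Bernoulli($\mu_k$), independent across $k$, $t$ and of the arrivals. $\mu^*=\max_k\mu_k$ is attained at a unique server $k^*$ and $\lambda<\mu^*$. A policy chooses $\kappa(t)\in[K]$ based on past observations; $S(t)=R_{\kappa(t)}(t)$ and $Q(t)=(Q(t-1)+A(t)-S(t))^+$. The genie queue $Q^*(t)=(Q^*(t-1)+A(t)-R_{k^*}(t))^+$ uses the same arrivals. $Q(0)$ and $Q^*(0)$ are both distributed according to the stationary distribution of $Q^*$. Queue-regret: $\Psi(t)=\mathbb{E}[Q(t)-Q^*(t)]$. Let $\epsilon=\mu^*-\lambda$ and $\Delta=\mu^*-\max_{k\ne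 k^*}\mu_k$. Algorithm Q-ThS: let $T_k(t)$ be the number of slots in $\{1,\dots,t\}$ in which server $k$ was scheduled, and $\hat\mu_k(t)$ the empirical mean of the services observed from server $k$ before time $t$. At time $t$, draw an independent Bernoulli variable $\mathsf E(t)$ with mean $\min\{1,3K\log^2 t/t\}$. If $\mathsf E(t)=1$ (explore), schedule a server chosen uniformly at random. Otherwise (exploit), for each $k$ draw independently $\hat\theta_k(t)\sim\mathrm{Beta}(\hat\mu_k(t)T_k(t-1)+1,(1-\hat\mu_k(t))T_k(t-1)+1)$ and schedule $\kappa(t)\in\arg\max_k\hat\theta_k(t)$. *)

(* Defs.v *)
From HB Require Import structures.
From mathcomp Require Import all_boot all_order all_algebra.
From mathcomp Require Import all_classical all_reals all_analysis.
From mathcomp Require Import beta_distribution.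

Set Implicit Arguments.
Unset Strict Implicit.
Unset Printing Implicit Defensive.

Import Order.TTheory GRing.Theory Num.Def Num.Theory.
Import numFieldTopology.Exports.

Local Open Scope classical_set_scope.
Local Open Scope ring_scope.

(* Single-queue, K-server bandit.  The outcome of one time slot is          *)
(*   (A(s), (R_k(s))_k, kappa(s)) : arrival, all server services, and the   *)
(* scheduled server.  A sample path of length t is a t.-tuple of slots.     *)

Definition Slot (K : nat) := (bool * {ffun 'I_K -> bool} * 'I_K)%type.

Definition arr {K} (s : Slot K) : bool := s.1.1.
Definition serv {K} (s : Slot K) : {ffun 'I_K -> bool} := s.1.2.
Definition sched {K} (s : Slot K) : 'I_K := s.2.

Definition bern {R : realType} (p : R) (b : bool) : R := if b then p else 1 - p.

(* Observed history h = slots 1..t-1.  The policy observes (kappa(s), S(s)) *)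
(* with S(s) = R_{kappa(s)}(s).                                             *)
(* successes_k = mu_hat_k(t) * T_k(t-1), failures_k = (1 - mu_hat_k(t)) T_k(t-1) *)
Definition successes {K} (k : 'I_K) (h : seq (Slot K)) : nat :=
  count (fun s => (sched s == k) && serv s (sched s)) h.
Definition failures {K} (k : 'I_K) (h : seq (Slot K)) : nat :=
  count (fun s => (sched s == k) && ~~ serv s (sched s)) h.

(* Thompson-sampling (exploit) step: theta_j ~ Beta(successes_j + 1,      *)
(* failures_j + 1) independently; probability that server k attains the   *)
(* maximum, i.e. P(theta_j < theta_k for all j <> k)                       *)
(*   = \int P(theta_j < x for all j <> k) d(law of theta_k)(x).           *)
(* (ties have probability zero, so the tie-breaking rule is irrelevant).   *)
Definition ts_prob {R : realType} {K} (h : seq (Slot K)) (k : 'I_K) : R :=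
  fine (\int[@beta_prob R (successes k h).+1 (failures k h).+1]_x
          (\prod_(j < K | j != k)
              fine (@beta_prob R (successes j h).+1 (failures j h).+1
                      `]-oo, x[))%:E).

Definition explore_prob {R : realType} (K t : nat) : R :=
  minr 1 (3 * K%:R * (ln (t%:R : R)) ^+ 2 / t%:R).

(* law of kappa(t) given the history (E(t) marginalized out): with         *)
(* probability explore_prob a uniform server, otherwise Thompson sampling.  *)
Definition qths_sched_prob {R : realType} {K} (t : nat) (h : seq (Slot K))
    (k : 'I_K) : R :=
  explore_prob K t / K%:R + (1 - explore_prob K t) * ts_prob h k.

Definition slot_prob {R : realType} {K} (lam : R) (mu : 'I_K -> R) (t : nat)
    (h : seq (Slot K)) (s : Slot K) : R :=
  bern lam (arr s) * (\prod_(k < K) bern (mu k) (serv s k))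
  * qths_sched_prob t h (sched s).

Definition path_prob {R : realType} {K} (lam : R) (mu : 'I_K -> R) (t : nat)
    (w : t.-tuple (Slot K)) : R :=
  \prod_(i < t) slot_prob lam mu i.+1 (take i w) (tnth w i).

(* Q(t) = (Q(t-1) + A(t) - S(t))^+  (truncated subtraction on nat) *)
Definition queue {K} (q0 : nat) (w : seq (Slot K)) : nat :=
  foldl (fun q s => (q + arr s - serv s (sched s))%N) q0 w.

Definition genie_queue {K} (kstar : 'I_K) (q0 : nat) (w : seq (Slot K)) : nat :=
  foldl (fun q s => (q + arr s - serv s kstar)%N) q0 w.

Definition genie_trans {R : realType} (lam mustar : R) (m n : nat) : R :=
  \sum_(a : bool) \sum_(r : bool)
     bern lam a * bern mustar r * ((m + a - r)%N == n)%:R.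

Definition genie_stationary {R : realType} (lam mustar : R) (pi : nat -> R) :=
  (forall n, 0 <= pi n) /\
  series pi @ \oo --> (1 : R) /\
  (forall n, series (fun m => pi m * genie_trans lam mustar m n) @ \oo --> pi n).

(* Queue-regret Psi(t) = E[Q(t) - Q*(t)], with Q(0) = Q*(0) ~ pi,         *)
(* independent of arrivals, services and the algorithm's randomness.      *)
Definition queue_regret {R : realType} {K} (lam : R) (mu : 'I_K -> R)
    (kstar : 'I_K) (pi : nat -> R) (t : nat) : R :=
  limn (series (fun q0 => pi q0 *
     \sum_(w : t.-tuple (Slot K))
        path_prob lam mu w * ((queue q0 w)%:R - (genie_queue kstar q0 w)%:R))).

Definition gap {R : realType} {K} (mu : 'I_K -> R) (kstar : 'I_K) : R :=
  mu kstar - \big[maxr/0]_(k < K | k != kstar) mu k.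

Definition wfun {R : realType} (Delta : R) (t : nat) : R :=
  expR ((2 * ln (t%:R : R) / Delta) `^ (2 / 3)).
Definition v'fun {R : realType} (K : nat) (eps Delta : R) (t : nat) : R :=
  6 * K%:R / eps * wfun Delta t.
Definition vfun {R : realType} (K : nat) (eps Delta : R) (t : nat) : R :=
  24 / eps ^+ 2 * ln (t%:R : R)
  + 60 * K%:R / eps * (v'fun K eps Delta t * (ln (t%:R : R)) ^+ 2 / t%:R).

(* Main.v *)
Require Import Defs.
From HB Require Import structures.
From mathcomp Require Import all_boot all_order all_algebra.
From mathcomp Require Import all_classical all_reals all_analysis.
From mathcomp Require Import beta_distribution measurable_realfun.
From mathcomp Require Import ring lra zify.
Import Order.TTheory GRing.Theory Num.Def Num.Theory.
Import numFieldNormedType.Exports.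
Local Open Scope ring_scope.

Set Implicit Arguments.
Unset Strict Implicit.
Unset Printing Implicit Defensive.

(** With [L = ln t], [eps = mu* - lam], [v0 = 24 L / eps^2] and
    [w = exp ((2 L / Delta)^(2/3))], put [u = t - v0].  If the queue is empty at
    some time in [u, t], then from that time on it exceeds the genie queue by at
    most the number of slots of (u, t] where a server other than [kstar] is
    scheduled.  Past time [m0 = K w / 2] exploration alone has sampled every
    server a large multiple of [L] times, so up to an event of probability
    O(t^-4) Thompson sampling errs with probability O(t^-4), and the wrong slots
    of (u, t] are essentially the exploration slots: about [v0 * 6 K L^2 / t] of
    them.  The queue avoids 0 on [u, t] with probability O(t^-2): given a good
    history, [exp ((eps / 3) Q)] contracts by [exp (- 2 eps^2 / 9)] per slot, up
    to the exploration rate.  For busy periods starting before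
    [v' = 6 K w / eps], that rate sums to at most [3 K L^3], negligible against
    [K w] and hence against the total drift [eps t / 2 >= 6 K w]; later it is at
    most [eps / 20].  Since the regret never exceeds [t], these rare events, and
    the geometric tail of the stationary law, contribute O(1 / t). *)

(** * Beta laws with integer parameters, as polynomials *)

Section polynomial_primitive.
Context {R : realType}.
Implicit Types p q : {poly R}.
Local Notation mu := (@lebesgue_measure R).
Local Open Scope classical_set_scope.

(** At index 0 the formula divides by 0, and [0^-1 = 0] makes this the antiderivative that vanishes
    at 0. *)
Definition primp p : {poly R} := \poly_(i < (size p).+1) (p`_i.-1 / i%:R).

Lemma deriv_primp p : deriv (primp p) = p.
Proof.
apply/polyP => i; rewrite coef_deriv coef_poly ltnS.
case: ltnP => [isz|szi]; last by rewrite mul0rn nth_default.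
by rewrite -[LHS]mulr_natr divfK// pnatr_eq0.
Qed.

Lemma primp0 p : (primp p).[0] = 0.
Proof. by rewrite horner_coef0 coef_poly /= invr0 mulr0. Qed.

Lemma integral_deriv q (a b : R) : a <= b ->
  (\int[mu]_(x in `[a, b]) ((deriv q).[x])%:E = (q.[b] - q.[a])%:E)%E.
Proof.
rewrite le_eqVlt => /predU1P[<-|ab].
  by rewrite set_itv1 integral_set1 subrr.
rewrite (@continuous_FTC2 _ _ (horner q)) ?EFinB//.
- by apply/continuous_subspaceT => x; exact: continuous_horner.
- split.
  + by move=> x _; exact: derivable_horner.
  + by apply: cvg_at_right_filter; exact: continuous_horner.
  + by apply: cvg_at_left_filter; exact: continuous_horner.
- by move=> x _; rewrite derivE.
Qed.

Lemma deriv_prod (n : nat) (P : 'I_n -> {poly R}) :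
  deriv (\prod_(j < n) P j) = \sum_(k < n) deriv (P k) * \prod_(j < n | j != k) P j.
Proof.
elim: n P => [|n IH] P; first by rewrite !big_ord0 derivC.
rewrite big_ord_recl derivM IH big_ord_recl mulr_sumr; congr (_ * _ + _).
  rewrite [RHS]big_mkcond big_ord_recl /= mul1r; apply: eq_bigr => i _.
  by [].
apply: eq_bigr => k _; rewrite mulrCA; congr (_ * _).
rewrite [RHS]big_mkcond big_ord_recl /=; congr (_ * _).
rewrite big_mkcond; apply: eq_bigr => i _.
by rewrite (inj_eq lift_inj).
Qed.

End polynomial_primitive.

Section beta_polynomials.
Context {R : realType}.
Local Notation mu := (@lebesgue_measure R).
Local Open Scope classical_set_scope.

Definition beta_poly (a b : nat) : {poly R} :=
  (beta_fun a.+1 b.+1)^-1 *: ('X^a * (1 - 'X) ^+ b).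

Lemma horner_beta_poly a b (x : R) :
  (beta_poly a b).[x] = XMonemX a b x / beta_fun a.+1 b.+1.
Proof. rewrite /beta_poly hornerZ hornerM hornerXn horner_exp hornerD hornerN hornerX.
by rewrite -[1]polyC1 hornerC mulrC. Qed.

Lemma beta_poly_ge0 a b (x : R) : 0 <= x <= 1 -> 0 <= (beta_poly a b).[x].
Proof.
move=> x01; rewrite horner_beta_poly divr_ge0 ?beta_fun_ge0//.
by rewrite XMonemX_ge0.
Qed.

Definition beta_cdf (a b : nat) : {poly R} := primp (beta_poly a b).

Lemma beta_cdf0 a b : (beta_cdf a b).[0] = 0.
Proof. exact: primp0. Qed.

Lemma beta_pdf01 a b (x : R) : x \in `[0, 1]%R ->
  beta_pdf a.+1 b.+1 x = (beta_poly a b).[x].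
Proof. by move=> x01; rewrite /beta_pdf patchE mem_setE x01 horner_beta_poly. Qed.

Lemma beta_prob_itv01 a b (x y : R) : 0 <= x -> x <= y -> y <= 1 ->
  beta_prob a.+1 b.+1 `[x, y] = ((beta_cdf a b).[y] - (beta_cdf a b).[x])%:E.
Proof.
move=> x0 xy y1; rewrite -integral_beta_pdf// -integral_deriv//.
rewrite deriv_primp; apply: eq_integral => z; rewrite inE/= in_itv/= => /andP[xz zy].
by rewrite beta_pdf01// in_itv/= (le_trans x0 xz) (le_trans zy y1).
Qed.

Lemma beta_prob_out a b (A : set R) : measurable A -> A `&` `[0, 1] = set0 ->
  beta_prob a b A = 0%E.
Proof.
move=> mA A0; rewrite -integral_beta_pdf//; apply: integral0_eq => x Ax.
rewrite /beta_pdf patchE; case: ifPn; last by rewrite mul0r.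
by rewrite inE => x01; have : (A `&` `[0, 1]) x by []; rewrite A0.
Qed.

Lemma beta_cdf1 a b : (beta_cdf a b).[1] = 1.
Proof.
have := beta_prob_itv01 a b (lexx 0) ler01 (lexx 1).
by rewrite beta_prob01 beta_cdf0 subr0 => -[].
Qed.

(** The polynomial [beta_cdf] is a distribution function only on [0, 1]; clamping its argument
    extends it to the real line, as in [beta_prob_lt]. *)
Definition clamp (x : R) : R := minr 1 (maxr 0 x).

Lemma clamp01 x : 0 <= clamp x <= 1.
Proof. by rewrite /clamp le_min ge_min le_max !lexx ler01. Qed.

Lemma clamp_id x : 0 <= x <= 1 -> clamp x = x.
Proof. by move=> /andP[x0 x1]; rewrite /clamp max_r// min_r. Qed.

Lemma measurable_clamp : measurable_fun setT clamp.
Proof. by apply: measurable_minr => //; exact: measurable_maxr. Qed.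

Lemma beta_prob_lt a b (x : R) :
  beta_prob a.+1 b.+1 `]-oo, x[ = ((beta_cdf a b).[clamp x])%:E.
Proof.
have -> : beta_prob a.+1 b.+1 `]-oo, x[ = beta_prob a.+1 b.+1 `]-oo, x].
  rewrite -!integral_beta_pdf// integral_itv_bndo_bndc//.
  by apply/measurable_funTS/measurableT_comp => //; exact: measurable_beta_pdf.
have [x0|x0] := ltP x 0.
  rewrite beta_prob_out//.
    by rewrite /clamp max_l ?(ltW x0)// min_r// beta_cdf0.
  rewrite -subset0 => z /=; rewrite !in_itv/= => -[zx /andP[z0 _]].
  by have := lt_le_trans x0 (le_trans z0 zx); rewrite ltxx.
have c01 := clamp01 x.
(* For [x >= 0] the half-line splits into [[0, clamp x]] and two pieces outside [0, 1], which carry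
   no mass. *)
have E : `]-oo, x] = `]-oo, 0[%classic `|` (`[0, clamp x]%classic `|` (`]1, +oo[%classic `&` `]-oo, x]%classic)).
  apply/seteqP; split=> z /=; rewrite !in_itv/= andbT.
    move=> zx; have [z0|z0] := ltP z 0; first by left.
    right; have [z1|z1] := leP z 1; last by right.
    by left; rewrite /clamp le_min le_max z1 zx orbT.
  move=> [z0|[/andP[z0]|[]//]]; first exact: le_trans (ltW z0) x0.
  by rewrite /clamp max_r// le_min => /andP[].
rewrite E !measureU//=; [|exact: measurableI|
  |by apply: measurableU => //; exact: measurableI|]; last first.
- rewrite -subset0 => z /=; rewrite !in_itv/= ?andbT => -[z0 [/andP[z0' _]|[z1 _]]].
    by move: z0'; rewrite leNgt z0.
  by have := lt_trans z0 (lt_trans ltr01 z1); rewrite ltxx.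
- rewrite -subset0 => z /=; rewrite !in_itv/= ?andbT => -[/andP[_ zc] [z1 _]].
  by case/andP: c01 => _ /(le_trans zc); rewrite leNgt z1.
rewrite beta_prob_itv01//; [|by case/andP: c01..].
rewrite (@beta_prob_out _ _ `]-oo, 0[%classic)//; last first.
  rewrite -subset0 => z /=; rewrite !in_itv/= => -[z0 /andP[z0' _]].
  by move: z0'; rewrite leNgt z0.
rewrite beta_prob_out//; [|exact: measurableI|]; last first.
  rewrite -subset0 => z /=; rewrite !in_itv/= ?andbT => -[[z1 _] /andP[_]].
  by rewrite leNgt z1.
by rewrite beta_cdf0 subr0 add0e adde0.
Qed.

Lemma beta_cdf_ge0 a b (x : R) : 0 <= x <= 1 -> 0 <= (beta_cdf a b).[x].
Proof.
by move=> x01; rewrite -lee_fin -(clamp_id x01) -beta_prob_lt measure_ge0.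
Qed.

Lemma beta_cdf_le1 a b (x : R) : 0 <= x <= 1 -> (beta_cdf a b).[x] <= 1.
Proof.
by move=> x01; rewrite -lee_fin -(clamp_id x01) -beta_prob_lt probability_le1.
Qed.

Lemma beta_cdf_le a b (x y : R) : 0 <= x -> x <= y -> y <= 1 ->
  (beta_cdf a b).[x] <= (beta_cdf a b).[y].
Proof.
by move=> x0 xy y1; rewrite -subr_ge0 -lee_fin -beta_prob_itv01.
Qed.

(** Turns the integral that defines [ts_prob] into a polynomial evaluated at 1; the bounds on [q]
    supply integrability. *)
Lemma integral_beta_clamp a b (q : {poly R}) :
  (forall x, 0 <= x <= 1 -> 0 <= q.[x] <= 1) ->
  (\int[beta_prob a.+1 b.+1]_x (q.[clamp x])%:E =
   ((primp (q * beta_poly a b)).[1])%:E)%E.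
Proof.
move=> q01.
have mq : measurable_fun setT (fun x : R => q.[clamp x]).
  apply: (measurableT_comp (f := horner q)) measurable_clamp.
  by apply: continuous_measurable_fun; exact: continuous_horner.
rewrite integral_beta_prob//=; last 2 first.
  exact/measurable_EFinP.
  apply: (@le_lt_trans _ _ (\int[beta_prob a.+1 b.+1]_x cst 1%:E x)%E).
    apply: ge0_le_integral => //=.
    - by do 2!apply: measurableT_comp => //.
    - by move=> x _; have /andP[? ?] := q01 _ (clamp01 x); rewrite lee_fin ger0_norm.
  by rewrite integral_cst//= mul1e probability_setT ltry.
transitivity (\int[mu]_(x in `[0%R, 1%R]) ((q * beta_poly a b).[x])%:E)%E.
  rewrite [RHS]integral_mkcond; apply: eq_integral => x _.
  rewrite patchE; case: ifPn; rewrite ?mem_setE => x01.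
    by rewrite beta_pdf01// clamp_id// -EFinM hornerM.
  by rewrite /beta_pdf patchE mem_setE (negbTE x01) mul0r mule0.
by rewrite -[X in horner X]deriv_primp integral_deriv// primp0 subr0.
Qed.

(** * Tail bounds for Beta laws, by comparison of derivatives *)

Lemma deriv_le_increment (p q : {poly R}) x y : x <= y ->
  (forall z, x <= z <= y -> (deriv p).[z] <= (deriv q).[z]) ->
  p.[y] - p.[x] <= q.[y] - q.[x].
Proof.
move=> xy pq; rewrite -subr_ge0 -lee_fin.
have -> : q.[y] - q.[x] - (p.[y] - p.[x]) = (q - p).[y] - (q - p).[x].
  by rewrite !hornerE; lra.
rewrite -integral_deriv//; apply: integral_ge0 => z /=; rewrite in_itv/= => zxy.
by rewrite derivB lee_fin !hornerE subr_ge0 pq.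
Qed.

Lemma deriv_eq_increment (p q : {poly R}) (x y : R) :
  deriv p = deriv q -> x <= y -> p.[y] - p.[x] = q.[y] - q.[x].
Proof.
by move=> pq xy; apply/le_anti/andP; split; apply: deriv_le_increment => // z _;
  rewrite pq.
Qed.

(** Raising the first parameter by one multiplies the Beta function by a ratio of the form
    [(a + i + 1) / (a + b + i + 2)]. The product of [n] such ratios is the n-th moment of the
    law. *)
Lemma beta_fun_geometric a b n (rho : R) : 0 <= rho ->
  (forall i, (i < n)%N -> (a + i.+1)%:R <= rho * (a + b + i.+2)%:R) ->
  beta_fun (a + n).+1 b.+1 <= rho ^+ n * beta_fun a.+1 b.+1.
Proof.
move=> rho0; elim: n => [|n IH] H; first by rewrite addn0 mul1r.
have E : beta_fun (a + n.+1).+1 b.+1 =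
   (a + n.+1)%:R / (a + b + n.+2)%:R * beta_fun (a + n).+1 b.+1 :> R.
  rewrite !beta_fun_fact.
  have -> : (a + n.+1 + b).+1 = (a + n + b).+2 by lia.
  have -> : (a + b + n.+2)%N = (a + n + b).+2 by lia.
  rewrite addnS !factS !natrM.
  have h1 : (a + n + b).+2%:R != 0 :> R by rewrite pnatr_eq0.
  have h2 : (a + n + b).+1%:R != 0 :> R by rewrite pnatr_eq0.
  have h3 : (a + n + b)`!%:R != 0 :> R by rewrite pnatr_eq0 -lt0n fact_gt0.
  move: h1 h2 h3; move: (_.+2%:R : R) ((a + n + b).+1%:R : R) (_`!%:R : R).
  by move=> x y z x0 y0 z0; field; rewrite x0 y0 z0.
rewrite E exprS -[leRHS]mulrA; apply: ler_pM => //.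
- exact: beta_fun_ge0.
- by rewrite ler_pdivrMr; [exact: H|rewrite ltr0n addnS].
- by apply: IH => i ni; apply: H; lia.
Qed.

(* Markov's inequality for the n-th moment. *)
Lemma beta_upper_tail_geometric a b n (rho y : R) : 0 <= rho -> 0 < y <= 1 ->
  (forall i, (i < n)%N -> (a + i.+1)%:R <= rho * (a + b + i.+2)%:R) ->
  1 - (beta_cdf a b).[y] <= (rho / y) ^+ n.
Proof.
move=> rho0 /andP[y0 y1] H.
set B := beta_fun a.+1 b.+1 : R; set B' := beta_fun (a + n).+1 b.+1 : R.
have B0 : 0 < B := beta_fun_gt0 _ _; have B'0 : 0 < B' := beta_fun_gt0 _ _.
(* [c] is the n-th moment over [y ^ n]. Times the density with parameter [a + n] it gives
   [(z / y) ^ n] times the original density, which dominates the latter on [y, 1]. *)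
pose c := y ^- n * (B' / B).
have c0 : 0 <= c by rewrite mulr_ge0 ?invr_ge0 ?exprn_ge0 ?divr_ge0// ltW.
apply: (@le_trans _ _ c); last first.
  rewrite /c expr_div_n [leRHS]mulrC ler_pM2l ?invr_gt0 ?exprn_gt0//.
  by rewrite ler_pdivrMr// beta_fun_geometric.
have := @deriv_le_increment (beta_cdf a b) (c *: beta_cdf (a + n) b) y 1 y1.
rewrite derivZ !deriv_primp !hornerZ !beta_cdf1 mulr1 => /(_ _)/le_trans; apply.
  move=> z /andP[yz z1]; rewrite hornerZ !horner_beta_poly -/B -/B' /c.
  have z01 : z \in `[0, 1]%R by rewrite in_itv/= z1 (le_trans (ltW y0)).
  have -> : y ^- n * (B' / B) * (XMonemX (a + n) b z / B') =
     (z / y) ^+ n * (XMonemX a b z / B).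
    rewrite /XMonemX exprD expr_div_n; field.
    by rewrite !gt_eqF ?exprn_gt0.
  rewrite ler_peMl//; first by rewrite divr_ge0 ?XMonemX_ge0 ?ltW.
  by rewrite exprn_ege1// ler_pdivlMr// mul1r.
rewrite lerBlDr lerDl mulr_ge0// beta_cdf_ge0// y1 andbT ltW//.
Qed.

(** Mirror image: Markov's inequality for the n-th moment of [1 - X]. *)
Lemma beta_lower_tail_geometric a b n (rho y : R) : 0 <= rho -> 0 <= y < 1 ->
  (forall i, (i < n)%N -> (b + i.+1)%:R <= rho * (a + b + i.+2)%:R) ->
  (beta_cdf a b).[y] <= (rho / (1 - y)) ^+ n.
Proof.
move=> rho0 /andP[y0 y1] H.
set B := beta_fun a.+1 b.+1 : R; set B' := beta_fun a.+1 (b + n).+1 : R.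
have B0 : 0 < B := beta_fun_gt0 _ _; have B'0 : 0 < B' := beta_fun_gt0 _ _.
have y10 : 0 < 1 - y by rewrite subr_gt0.
pose c := (1 - y) ^- n * (B' / B).
have c0 : 0 <= c.
  by rewrite mulr_ge0 ?invr_ge0 ?exprn_ge0 ?divr_ge0// ltW.
apply: (@le_trans _ _ c); last first.
  rewrite /c expr_div_n [leRHS]mulrC ler_pM2l ?invr_gt0 ?exprn_gt0//.
  rewrite ler_pdivrMr// /B' /B !(beta_fun_sym a.+1) beta_fun_geometric// => i ni.
  by rewrite (addnC b a) H.
have := @deriv_le_increment (beta_cdf a b) (c *: beta_cdf a (b + n)) 0 y y0.
rewrite derivZ !deriv_primp !hornerZ !beta_cdf0 mulr0 !subr0 => /(_ _)/le_trans; apply.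
  move=> z /andP[z0 zy]; rewrite hornerZ !horner_beta_poly -/B -/B' /c.
  have z01 : z \in `[0, 1]%R by rewrite in_itv/= z0 (le_trans zy (ltW y1)).
  have -> : (1 - y) ^- n * (B' / B) * (XMonemX a (b + n) z / B') =
     ((1 - z) / (1 - y)) ^+ n * (XMonemX a b z / B).
    have XE i j : XMonemX i j z = z ^+ i * (1 - z) ^+ j by [].
    rewrite !XE exprD expr_div_n; field.
    by rewrite !gt_eqF ?exprn_gt0.
  rewrite ler_peMl//; first by rewrite divr_ge0 ?XMonemX_ge0 ?ltW.
  by rewrite exprn_ege1// ler_pdivlMr// mul1r lerB.
by rewrite ler_piMr// beta_cdf_le1// y0 ltW.
Qed.

(** As [y <= 1], the base is at most [1 - d], hence at most [exp (- d)]. Rounding [d N] down loses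
    less than one factor, whence the summand [d] in the exponent. *)
Lemma geometric_le_expR (y d : R) (N : nat) : 0 < d -> 0 < y <= 1 -> d <= y ->
  ((y - d) / y) ^+ Num.truncn (d * N%:R) <= expR (d - d ^+ 2 * N%:R).
Proof.
move=> d0 /andP[y0 y1] dy; set n := Num.truncn _.
have dN : 0 <= d * N%:R by rewrite mulr_ge0// ltW.
have /andP[_ nl] := truncn_itv dN.
apply: (@le_trans _ _ (expR (- d) ^+ n)).
  apply: lerXn2r; rewrite ?nnegrE ?expR_ge0//.
    by rewrite divr_ge0 ?subr_ge0// ltW.
  apply: le_trans (expR_ge1Dx _).
  by rewrite ler_pdivrMr// mulrDl mul1r lerD2l mulNr lerN2 ler_piMr// ltW.
rewrite -expRM_natl ler_expR -/n.
have : d * N%:R * d <= n.+1%:R * d by rewrite ler_wpM2r// ltW.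
rewrite -natr1; nra.
Qed.

(** Uses [n], the integer part of [d (a + b)], and [rho = y - d]. Of the margin [2 d], one half
    absorbs the growth of [a] up to [a + n]; the other makes the ratio [rho / y] smaller than 1. *)
Lemma beta_upper_tail a b (y d : R) : 0 < d -> d <= y <= 1 ->
  a%:R <= (y - 2 * d) * (a + b)%:R ->
  1 - (beta_cdf a b).[y] <= expR (d - d ^+ 2 * (a + b)%:R).
Proof.
move=> d0 /andP[dy y1] H.
have y0 : 0 < y := lt_le_trans d0 dy.
have dN : 0 <= d * (a + b)%:R by rewrite mulr_ge0// ltW.
apply: le_trans (geometric_le_expR _ d0 _ dy); last by rewrite y0.
apply: beta_upper_tail_geometric; rewrite ?subr_ge0 ?y0// => i ni.
have /andP[nN _] := truncn_itv dN.
have : i.+1%:R <= d * (a + b)%:R by apply: le_trans nN; rewrite ler_nat.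
rewrite (natrD _ (a + b)) (natrD _ a i.+1); move: H; set N := (a + b)%:R => H h.
have : 0 <= (y - d) * i.+2%:R by rewrite mulr_ge0// subr_ge0.
lra.
Qed.

Lemma beta_lower_tail a b (y d : R) : 0 < d -> 0 <= y <= 1 - d ->
  b%:R <= (1 - y - 2 * d) * (a + b)%:R ->
  (beta_cdf a b).[y] <= expR (d - d ^+ 2 * (a + b)%:R).
Proof.
move=> d0 /andP[y0 yd] H.
have dy : d <= 1 - y by lra.
have y1 : y < 1 by lra.
have dN : 0 <= d * (a + b)%:R by rewrite mulr_ge0// ltW.
apply: le_trans (geometric_le_expR _ d0 _ dy); last by lra.
apply: beta_lower_tail_geometric; [lra|by rewrite y0|] => i ni.
have /andP[nN _] := truncn_itv dN.
have : i.+1%:R <= d * (a + b)%:R by apply: le_trans nN; rewrite ler_nat.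
rewrite (natrD _ (a + b)) (natrD _ b i.+1); move: H; set N := (a + b)%:R => H h.
have : 0 <= (1 - y - d) * i.+2%:R by rewrite mulr_ge0// subr_ge0.
lra.
Qed.

End beta_polynomials.

(** * Thompson sampling *)

Lemma prodr_in01 {R : realType} (I : finType) (P : pred I) (g : I -> R) :
  (forall i, P i -> 0 <= g i <= 1) -> 0 <= \prod_(i | P i) g i <= 1.
Proof.
move=> g01; apply: (big_ind (fun z => 0 <= z <= 1)) => //.
- by rewrite ler01 lexx.
- by move=> x y /andP[x0 x1] /andP[y0 y1]; rewrite mulr_ge0//= mulr_ile1.
Qed.

Section thompson.
Context {R : realType} {K : nat}.
Implicit Types (h : seq (Slot K)) (k : 'I_K).
Local Open Scope classical_set_scope.

Let F h k : {poly R} := beta_cdf (successes k h) (failures k h).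
Let f h k : {poly R} := beta_poly (successes k h) (failures k h).

Lemma ts_probE h k :
  ts_prob h k = (primp ((\prod_(j < K | j != k) F h j) * f h k)).[1] :> R.
Proof.
rewrite /ts_prob.
under eq_integral => x _.
  under eq_bigr do rewrite beta_prob_lt /=.
  rewrite -horner_prod; over.
rewrite integral_beta_clamp//= => x x01; rewrite horner_prod.
by apply: prodr_in01 => j _; rewrite beta_cdf_ge0 ?beta_cdf_le1.
Qed.

Lemma ts_prob_ge0 h k : 0 <= ts_prob h k :> R.
Proof.
rewrite /ts_prob; apply/fine_ge0/integral_ge0 => x _; rewrite lee_fin.
by apply: prodr_ge0 => j _; exact/fine_ge0/measure_ge0.
Qed.

(* The integrands add up to the derivative of the product of the distribution
   functions.  Only this inequality is needed: all expectations below are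
   estimated from above, so a sub-probability suffices. *)
Lemma sum_ts_prob_le1 h : \sum_(k < K) ts_prob h k <= 1 :> R.
Proof.
under eq_bigr do rewrite ts_probE.
rewrite -horner_sum.
set P := \sum_(k < K) _.
have P0 : P.[0] = 0 by rewrite horner_sum big1// => k _; rewrite primp0.
have dP : deriv P = deriv (\prod_(j < K) F h j).
  rewrite deriv_prod raddf_sum; apply: eq_bigr => k _ /=.
  by rewrite !deriv_primp mulrC.
have := deriv_eq_increment dP ler01; rewrite P0 subr0 => ->.
rewrite !horner_prod big1 => [|k _]; last exact: beta_cdf1.
by rewrite lerBlDr lerDl prodr_ge0// => k _; rewrite beta_cdf0.
Qed.

(** The winning sample of [k] is either below [y], which forces the sample of [k'] below [y], or
    above [y]. Accordingly the integral is split at [y]. *)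
Lemma ts_prob_le h k k' (y : R) : k' != k -> 0 <= y <= 1 ->
  ts_prob h k <= (F h k').[y] + (1 - (F h k).[y]).
Proof.
move=> k'k /andP[y0 y1]; rewrite ts_probE.
set H := _ * _.
have Hle z : 0 <= z <= 1 -> H.[z] <= (F h k').[z] * (f h k).[z].
  move=> z01; rewrite hornerM ler_wpM2r ?beta_poly_ge0// horner_prod.
  rewrite (bigD1 k')//= ler_piMr ?beta_cdf_ge0//.
  have /andP[//] : 0 <= \prod_(j < K | (j != k) && (j != k')) (F h j).[z] <= 1.
  by apply: prodr_in01 => j _; rewrite beta_cdf_ge0 ?beta_cdf_le1.
have -> : (primp H).[1] = ((primp H).[y] - (primp H).[0]) +
    ((primp H).[1] - (primp H).[y]) by rewrite primp0; lra.
apply: lerD.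
  have := @deriv_le_increment _ (primp H) ((F h k').[y] *: F h k) 0 y y0.
  rewrite derivZ !deriv_primp !hornerZ beta_cdf0 mulr0 subr0 => /(_ _)/le_trans; apply.
    move=> z /andP[z0 zy]; have z1 := le_trans zy y1.
    rewrite hornerZ; apply: le_trans (Hle _ _) _; first by rewrite z0.
    by rewrite ler_wpM2r ?beta_poly_ge0 ?z0// beta_cdf_le.
  by rewrite ler_piMr ?beta_cdf_ge0 ?beta_cdf_le1 ?y0.
have := @deriv_le_increment _ (primp H) (F h k) y 1 y1.
rewrite !deriv_primp beta_cdf1; apply => z /andP[yz z1].
have z01 : 0 <= z <= 1 by rewrite z1 (le_trans y0).
apply: le_trans (Hle _ z01) _.
by rewrite ler_piMl ?beta_poly_ge0// beta_cdf_le1.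
Qed.

Lemma ts_prob_tail h k k' (y d : R) : k' != k -> 0 < d -> d <= y <= 1 - d ->
  (successes k h)%:R <= (y - 2 * d) * (successes k h + failures k h)%:R ->
  (failures k' h)%:R <=
    (1 - y - 2 * d) * (successes k' h + failures k' h)%:R ->
  ts_prob h k <= expR (d - d ^+ 2 * (successes k h + failures k h)%:R) +
                 expR (d - d ^+ 2 * (successes k' h + failures k' h)%:R).
Proof.
move=> k'k d0 /andP[dy yd] Hs Hf; rewrite addrC.
apply: le_trans (ts_prob_le h k'k (y := y) _) _; first by lra.
apply: lerD.
  by apply: beta_lower_tail => //; lra.
by apply: beta_upper_tail => //; lra.
Qed.

End thompson.

(** * The stationary law of the genie queue *)

Lemma cvg_series_finite_support {R : realType} (u : nat -> R) (N : nat) (l : R) :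
  (forall n, (N <= n)%N -> u n = 0) -> (series u @ \oo --> l)%classic ->
  l = \sum_(0 <= i < N) u i.
Proof.
move=> u0 ul; apply: (cvg_unique _ ul) => //.
apply: cvg_near_cst; exists N => // n /= Nn.
rewrite /series/= (big_cat_nat (n := N))//= [X in _ + X]big_nat_cond [X in _ + X]big1 ?addr0//.
by move=> i /andP[/andP[Ni _] _]; exact: u0.
Qed.

Section stationary.
Context {R : realType}.
Variables (lam mustar : R) (pi : nat -> R).
Local Open Scope classical_set_scope.
Hypotheses (lam0 : 0 <= lam) (mu1 : mustar <= 1) (lt_lam_mu : lam < mustar).
Hypothesis stat : genie_stationary lam mustar pi.

Let pi_ge0 n : 0 <= pi n. Proof. by case: stat => + _; apply. Qed.

Lemma genie_transE m n : genie_trans lam mustar m n =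
  lam * mustar * (m == n)%:R + lam * (1 - mustar) * (m.+1 == n)%:R +
  (1 - lam) * mustar * (m.-1 == n)%:R + (1 - lam) * (1 - mustar) * (m == n)%:R.
Proof.
rewrite /genie_trans !big_bool /= /bern !addn1 !addn0 subn1 subn0 subn1 subn0 /=.
by rewrite !addrA.
Qed.

(** Detailed balance of a birth-death chain: the genie queue moves by at most one, so by induction
    the flow up across each cut equals the flow down. *)
Lemma stationary_balance n :
  mustar * (1 - lam) * pi n.+1 = lam * (1 - mustar) * pi n.
Proof.
have [_ [_ st]] := stat.
elim: n => [|n IH].
  have z k : (2 <= k)%N -> pi k * genie_trans lam mustar k 0 = 0.
    by case: k => [|[|k]]// _; rewrite genie_transE /=; ring.
  have := cvg_series_finite_support z (st 0%N).
  rewrite !big_nat_recr//= big_nil !genie_transE/=; lra.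
have z k : (n.+3 <= k)%N -> pi k * genie_trans lam mustar k n.+1 = 0.
  move=> nk; rewrite genie_transE.
  have -> : (k == n.+1) = false by lia.
  have -> : (k.+1 == n.+1) = false by lia.
  have -> : (k.-1 == n.+1) = false by lia.
  by rewrite !mulr0 !addr0 mulr0.
have := cvg_series_finite_support z (st n.+1).
rewrite !big_nat_recr//= big_nat_cond big1; last first.
  move=> k /andP[/andP[_ kn] _]; rewrite genie_transE.
  have -> : (k == n.+1) = false by lia.
  have -> : (k.+1 == n.+1) = false by lia.
  have -> : (k.-1 == n.+1) = false by lia.
  by rewrite !mulr0 !addr0 mulr0.
rewrite !genie_transE/= !eqxx.
have -> : (n == n.+1) = false by lia.
have -> : (n.-1 == n.+1) = false by lia.
have -> : (n.+2 == n.+1) = false by lia.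
have -> : (n.+3 == n.+1) = false by lia.
rewrite /= => E; move: IH E; lra.
Qed.

Let eps := mustar - lam.

(** The coefficients in the balance equation differ by exactly [eps], and
    [mustar * (1 - lam) <= 1]. *)
Lemma stationary_decay n : pi n.+1 <= (1 - eps) * pi n.
Proof.
have mu0 : 0 < mustar by exact: le_lt_trans lt_lam_mu.
have l1 : 0 < 1 - lam by rewrite subr_gt0 (lt_le_trans lt_lam_mu).
have ml : 0 < mustar * (1 - lam) by rewrite mulr_gt0.
rewrite -(ler_pM2l ml) stationary_balance mulrA ler_wpM2r// /eps.
have h : mustar * (1 - lam) <= 1 by move: lam0 mu1 => ? ?; nra.
have e0 : 0 < mustar - lam by rewrite subr_gt0.
have := ler_wpM2l (ltW e0) h; lra.
Qed.

Lemma stationary_geometric q n : pi (q + n) <= (1 - eps) ^+ q * pi n.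
Proof.
have e1 : 0 <= 1 - eps by rewrite /eps; move: lam0 mu1 => ? ?; lra.
elim: q => [|q IH]; first by rewrite mul1r.
rewrite addSn exprS -mulrA (le_trans (stationary_decay _))//.
by rewrite ler_wpM2l.
Qed.

Lemma stationary_mass n : \sum_(0 <= i < n) pi i <= 1.
Proof.
have [_ [cv _]] := stat.
have ndec : nondecreasing_seq (series pi).
  by apply: nondecreasing_series => i _ _; exact: pi_ge0.
by have := nondecreasing_cvgn_le ndec (cvgP _ cv) n; rewrite (cvg_lim _ cv).
Qed.

Lemma stationary_tail q n : \sum_(q <= i < n) pi i <= expR (- eps * q%:R).
Proof.
have e1 : 0 <= 1 - eps by rewrite /eps; move: lam0 mu1 => ? ?; lra.
have [nq|qn] := leqP n q; first by rewrite big_geq// expR_ge0.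
rewrite -{1}[q]add0n big_addn.
apply: (@le_trans _ _ (\sum_(0 <= i < n - q) (1 - eps) ^+ q * pi i)).
  by apply: ler_sum => i _; rewrite addnC stationary_geometric.
rewrite -mulr_sumr; apply: (@le_trans _ _ ((1 - eps) ^+ q)).
  by rewrite ler_piMr ?exprn_ge0// stationary_mass.
rewrite mulrC expRM_natl lerXn2r// ?nnegrE ?expR_ge0//.
by apply: le_trans (expR_ge1Dx _).
Qed.

End stationary.

(** * Expectations over sample paths *)

(** Squaring [1 - x / 2 <= exp (- x / 2)] bounds [exp x] by the inverse of [(1 - x / 2) ^ 2]; the
    quadratic dominates that inverse as long as [1 - 3 x + x ^ 2 >= 0]. *)
Lemma expR_le_quadratic {R : realType} (x : R) : `|x| <= 3^-1 ->
  expR x <= 1 + x + x ^+ 2.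
Proof.
rewrite ler_norml => /andP[xl xu].
have h : (1 - x / 2) ^+ 2 * expR x <= 1.
  have : (1 - x / 2) ^+ 2 <= expR (- x).
    have -> : - x = 2%:R * (- x / 2) by field.
    rewrite expRM_natl lerXn2r ?nnegrE ?expR_ge0//; first by lra.
    by rewrite (le_trans _ (expR_ge1Dx _))// mulNr.
  by rewrite expRN -[leRHS]div1r ler_pdivlMr// expR_gt0.
have : 1 <= (1 - x / 2) ^+ 2 * (1 + x + x ^+ 2) by nra.
move/(le_trans h); rewrite ler_pM2l// exprn_gt0//; lra.
Qed.

Lemma prod_rcons_tuple (R : comPzRingType) (T : Type) n
    (phi : nat -> seq T -> T -> R) (w : n.-tuple T) (s : T) :
  \prod_(i < n.+1) phi i.+1 (take i (rcons_tuple w s)) (tnth (rcons_tuple w s) i)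
  = (\prod_(i < n) phi i.+1 (take i w) (tnth w i)) * phi n.+1 w s.
Proof.
rewrite big_ord_recr /=; congr (_ * _).
  apply: eq_bigr => i _; rewrite !(tnth_nth s) /= nth_rcons size_tuple ltn_ord.
  by rewrite -cats1 takel_cat// size_tuple ltnW.
rewrite (tnth_nth s) /= nth_rcons size_tuple ltnn eqxx.
by rewrite -cats1 takel_cat ?size_tuple// take_oversize ?size_tuple.
Qed.

Section process.
Context {R : realType} {K : nat}.
Variables (lam : R) (mu : 'I_K -> R).
Hypotheses (K_gt0 : (0 < K)%N) (lam01 : 0 <= lam <= 1).
Hypothesis mu01 : forall k, 0 <= mu k <= 1.
Implicit Types (h : seq (Slot K)) (s : Slot K) (f g : seq (Slot K) -> R).

Local Notation q h k := (qths_sched_prob (size h).+1 h k : R).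

Lemma explore_prob01 t : 0 <= (explore_prob K t : R) <= 1.
Proof.
rewrite /explore_prob le_min ge_min ler01 lexx /= andbT.
by rewrite divr_ge0// mulr_ge0 ?sqr_ge0// mulr_ge0.
Qed.

Lemma sched_prob_ge t h k :
  explore_prob K t / K%:R <= qths_sched_prob t h k :> R.
Proof.
have /andP[_ e1] := explore_prob01 t.
by rewrite /qths_sched_prob lerDl mulr_ge0 ?subr_ge0// ts_prob_ge0.
Qed.

Lemma sched_prob_ge0 t h k : 0 <= qths_sched_prob t h k :> R.
Proof.
apply: le_trans (sched_prob_ge t h k).
by rewrite divr_ge0//; case/andP: (explore_prob01 t).
Qed.

Lemma sum_sched_prob_le1 t h : \sum_(k < K) qths_sched_prob t h k <= 1 :> R.
Proof.
have /andP[_ e1] := explore_prob01 t.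
rewrite /qths_sched_prob big_split/= sumr_const card_ord -mulr_sumr.
rewrite -[_ / _ *+ _]mulr_natr divfK ?pnatr_eq0 -?lt0n//.
have := ler_wpM2l (_ : 0 <= 1 - explore_prob K t) (sum_ts_prob_le1 (R := R) h).
rewrite subr_ge0 => /(_ e1); lra.
Qed.

Lemma bern_ge0 (p : R) b : 0 <= p <= 1 -> 0 <= bern p b.
Proof. by case/andP; case: b => //= _; rewrite subr_ge0. Qed.

Lemma slot_prob_ge0 t h s : 0 <= slot_prob lam mu t h s.
Proof.
rewrite /slot_prob !mulr_ge0 ?bern_ge0 ?sched_prob_ge0//.
by apply: prodr_ge0 => k _; rewrite bern_ge0.
Qed.

Lemma path_prob_ge0 n (w : n.-tuple (Slot K)) : 0 <= path_prob lam mu w.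
Proof. by apply: prodr_ge0 => i _; exact: slot_prob_ge0. Qed.

Lemma path_prob_rcons n (w : n.-tuple (Slot K)) s :
  path_prob lam mu (rcons_tuple w s) =
  path_prob lam mu w * slot_prob lam mu n.+1 w s.
Proof.
exact: (prod_rcons_tuple (slot_prob lam mu)).
Qed.

Definition Ev n f : R := \sum_(w : n.-tuple (Slot K)) path_prob lam mu w * f w.

(** The conditional expectation of [f] one slot later given the history [h]; [Ev_S] is then the
    tower property. The slot being drawn has number [size h + 1]. *)
Definition step f h : R :=
  \sum_s slot_prob lam mu (size h).+1 h s * f (rcons h s).

Lemma Ev0 f : Ev 0 f = f [::].
Proof.
rewrite /Ev (big_pred1 [tuple]) => [|w]; last by case: w => [[|? ?] ?].
by rewrite /path_prob big_ord0 mul1r.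
Qed.

Lemma Ev_S n f : Ev n.+1 f = Ev n (step f).
Proof.
have bij : bijective (fun p : n.-tuple (Slot K) * Slot K => rcons_tuple p.1 p.2).
  apply: inj_card_bij; last by rewrite card_prod !card_tuple expnSr.
  by move=> [w s] [w' s'] /(congr1 val)/= /rcons_inj[/val_inj -> ->].
rewrite /Ev (reindex _ (onW_bij _ bij)) /= -(pair_bigA_idem _ (fun w s =>
  path_prob lam mu (rcons_tuple w s) * f (rcons w s)))//=; last exact: addr0.
apply: eq_bigr => w _; rewrite /step mulr_sumr; apply: eq_bigr => s _.
by rewrite path_prob_rcons size_tuple mulrA.
Qed.

Lemma Ev_le n f g : (forall h, size h = n -> f h <= g h) -> Ev n f <= Ev n g.
Proof.
move=> fg; apply: ler_sum => w _; apply: ler_wpM2l; first exact: path_prob_ge0.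
by apply: fg; rewrite size_tuple.
Qed.

Lemma Ev_S_le n f g :
  (forall h, size h = n -> step f h <= g h) -> Ev n.+1 f <= Ev n g.
Proof. by move=> H; rewrite Ev_S; exact: Ev_le. Qed.

Lemma EvD n f g : Ev n (fun h => f h + g h) = Ev n f + Ev n g.
Proof. by rewrite -big_split; apply: eq_bigr => w _; rewrite mulrDr. Qed.

Lemma EvZ n c f : Ev n (fun h => c * f h) = c * Ev n f.
Proof. by rewrite mulr_sumr; apply: eq_bigr => w _; rewrite mulrCA. Qed.

Lemma Ev_sum n (I : Type) (r : seq I) (P : pred I) (F : I -> seq (Slot K) -> R) :
  Ev n (fun h => \sum_(i <- r | P i) F i h) = \sum_(i <- r | P i) Ev n (F i).
Proof.
by rewrite /Ev exchange_big; apply: eq_bigr => w _; rewrite mulr_sumr.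
Qed.

Lemma step_le f g h : (forall s, f (rcons h s) <= g (rcons h s)) ->
  step f h <= step g h.
Proof.
by move=> fg; apply: ler_sum => s _; rewrite ler_wpM2l// slot_prob_ge0.
Qed.

(** The sum of products factors over the servers, and every factor other than that of [k] is 1. *)
Lemma sum_serv_marginal (k : 'I_K) (G : bool -> R) :
  \sum_(r : {ffun 'I_K -> bool}) (\prod_(j < K) bern (mu j) (r j)) * G (r k) =
  \sum_b bern (mu k) b * G b.
Proof.
pose H (j : 'I_K) (b : bool) := bern (mu j) b * (if j == k then G b else 1).
transitivity (\sum_(r : {ffun 'I_K -> bool}) \prod_(j < K) H j (r j)).
  apply: eq_bigr => r _; rewrite /H big_split /=; congr (_ * _).
  by rewrite -big_mkcond big_pred1_eq.
rewrite -bigA_distr_bigA (bigD1 k)//= [X in _ * X]big1 => [|j /negbTE jk].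
  by rewrite mulr1; apply: eq_bigr => b _; rewrite /H eqxx.
by rewrite big_bool /H jk /bern /= !mulr1 subrKC.
Qed.

(** All one-slot estimates go through this bound, in which only the arrival, the scheduled server
    and its service remain random. *)
Lemma step_local f h (F : bool -> bool -> 'I_K -> R) :
  (forall s, f (rcons h s) <= F (arr s) (serv s (sched s)) (sched s)) ->
  step f h <= \sum_k q h k *
    \sum_(a : bool) bern lam a * \sum_(b : bool) bern (mu k) b * F a b k.
Proof.
move=> fF; apply: (@le_trans _ _ (\sum_s slot_prob lam mu (size h).+1 h s *
    F (arr s) (serv s (sched s)) (sched s))).
  by apply: ler_sum => s _; rewrite ler_wpM2l// slot_prob_ge0.
rewrite le_eqVlt; apply/orP; left; apply/eqP.
rewrite -(pair_bigA_idem _ (fun (p : bool * {ffun 'I_K -> bool}) k =>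
   slot_prob lam mu (size h).+1 h (p, k) * F p.1 (p.2 k) k))/=; last exact: addr0.
rewrite exchange_big; apply: eq_bigr => k _ /=.
rewrite -(pair_bigA_idem _ (fun a r =>
   slot_prob lam mu (size h).+1 h (a, r, k) * F a (r k) k))/=; last exact: addr0.
rewrite mulr_sumr; apply: eq_bigr => a _.
rewrite -sum_serv_marginal !mulr_sumr; apply: eq_bigr => r _.
rewrite /slot_prob /arr /serv /sched /=; ring.
Qed.

Lemma step_cst_le c h : 0 <= c -> step (fun=> c) h <= c.
Proof.
move=> c0; apply: le_trans (step_local (F := fun _ _ _ => c) _) _ => //.
have E k : \sum_(a : bool) bern lam a * (\sum_(b : bool) bern (mu k) b * c) = c.
  by rewrite !big_bool /bern /=; ring.
under eq_bigr do rewrite E.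
by rewrite -mulr_suml ler_piMl// sum_sched_prob_le1.
Qed.

Lemma Ev_cst_le n c : 0 <= c -> Ev n (fun=> c) <= c.
Proof.
move=> c0; elim: n => [|n IH]; first by rewrite Ev0.
by apply: le_trans IH; apply: Ev_S_le => h _; exact: step_cst_le.
Qed.

(** Forgetting the slots after time [r] costs a total mass of at most 1, which gives an inequality
    for nonnegative [f]. *)
Lemma Ev_take n r f : (forall h, 0 <= f h) -> (r <= n)%N ->
  Ev n (fun h => f (take r h)) <= Ev r f.
Proof.
move=> f0; elim: n => [|n IH].
  by rewrite leqn0 => /eqP ->; rewrite !Ev0 /=.
rewrite leq_eqVlt => /predU1P[->|rn].
  by apply: Ev_le => h sh; rewrite take_oversize ?sh.
apply: le_trans (IH rn); apply: Ev_S_le => h sh.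
apply: le_trans (step_cst_le _ (f0 (take r h))).
by apply: step_le => s; rewrite -cats1 takel_cat// sh -ltnS.
Qed.

(** * Pull counts and concentration of the empirical means *)

Definition pulls (k : 'I_K) h : nat := (successes k h + failures k h)%N.

Lemma successes_rcons k h s :
  successes k (rcons h s) =
  (successes k h + ((sched s == k) && serv s (sched s)))%N.
Proof. by rewrite /successes -cats1 count_cat /= addn0. Qed.

Lemma failures_rcons k h s :
  failures k (rcons h s) =
  (failures k h + ((sched s == k) && ~~ serv s (sched s)))%N.
Proof. by rewrite /failures -cats1 count_cat /= addn0. Qed.

Lemma pulls_rcons k h s : pulls k (rcons h s) = (pulls k h + (sched s == k))%N.
Proof.
rewrite /pulls successes_rcons failures_rcons.
by case: (_ == _) (serv _ _) => [] []; rewrite /= ?addn0 ?addn1 ?addnS ?addSn.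
Qed.

Lemma pulls_take k r h : (pulls k (take r h) <= pulls k h)%N.
Proof.
rewrite -{2}(cat_take_drop r h) /pulls /successes /failures !count_cat.
by rewrite leq_add// leq_addr.
Qed.

(* Compensating by the random number of pulls avoids a union bound over it. *)
Lemma Ev_deviation (k : 'I_K) (th : R) n : `|th| <= 3^-1 ->
  Ev n (fun h => expR (th * ((successes k h)%:R - mu k * (pulls k h)%:R)
                       - th ^+ 2 * (pulls k h)%:R)) <= 1.
Proof.
move=> th3; have /andP[m0 m1] := mu01 k.
elim: n => [|n IH].
  rewrite Ev0 (_ : expR _ = 1)// -[RHS]expR0; congr expR.
  by rewrite /pulls /=; ring.
apply: le_trans IH; apply: Ev_S_le => h _.
set e := expR _.
apply: le_trans (step_local (F := fun _ b j => e *
   (if j == k then expR (th * (b%:R - mu k) - th ^+ 2) else 1)) _) _.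
  move=> s; rewrite /e pulls_rcons successes_rcons.
  case: eqP => [->|_] /=; last by rewrite !addn0 mulr1.
  by rewrite -expRD ler_expR !natrD; lra.
have E j : \sum_(a : bool) bern lam a * (\sum_(b : bool) bern (mu j) b *
   (e * (if j == k then expR (th * (b%:R - mu k) - th ^+ 2) else 1))) <= e.
  rewrite !big_bool /=; case: eqP => [->|_]; last by rewrite /bern; lra.
  (* The linear terms of the two quadratic bounds cancel in the mean; what remains, [1 + th ^ 2], is
     absorbed by the compensator [c]. *)
  rewrite !expRD /bern /=.
  set e1 := expR (th * _); set e0 := expR (th * _); set c := expR (- _).
  have h1 : e1 <= 1 + th * (1 - mu k) + th ^+ 2.
    apply: le_trans (expR_le_quadratic _) _.
      by rewrite normrM (le_trans _ th3)// ler_piMr// ger0_norm; lra.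
    by rewrite lerD2l exprMn ler_piMr ?sqr_ge0// exprn_ile1; lra.
  have h0 : e0 <= 1 + th * (0 - mu k) + th ^+ 2.
    apply: le_trans (expR_le_quadratic _) _.
      by rewrite normrM (le_trans _ th3)// ler_piMr// ler0_norm; lra.
    rewrite lerD2l exprMn ler_piMr ?sqr_ge0//.
    by rewrite sub0r sqrrN exprn_ile1; lra.
  have hc : c * (1 + th ^+ 2) <= 1.
    by rewrite /c expRN mulrC ler_pdivrMr ?expR_gt0// mul1r expR_ge1Dx.
  have c0 : 0 <= c by exact: expR_ge0.
  have e0' : 0 <= e by exact: expR_ge0.
  have hm : mu k * e1 + (1 - mu k) * e0 <= 1 + th ^+ 2.
    have := ler_wpM2l m0 h1.
    have := ler_wpM2l (_ : 0 <= 1 - mu k) h0; rewrite subr_ge0 => /(_ m1).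
    lra.
  have : e * (c * (mu k * e1 + (1 - mu k) * e0)) <= e * 1.
    by rewrite ler_wpM2l// (le_trans _ hc)// ler_wpM2l.
  lra.
apply: (@le_trans _ _ (\sum_(j < K) q h j * e)).
  by apply: ler_sum => j _; rewrite ler_wpM2l ?sched_prob_ge0.
by rewrite -mulr_suml ler_piMl ?expR_ge0 ?sum_sched_prob_le1.
Qed.

(** The expected number of exploration pulls of any one server during the first [n] slots. *)
Definition explore_mass n : R := \sum_(i < n) explore_prob K i.+1 / K%:R.

(** Slot by slot: [k] is pulled with probability at least [p], and then the weight shrinks by
    [exp (- 1) <= 1 / 2]. The mean factor is at most [1 - p / 2 <= exp (- p / 2)]. *)
Lemma Ev_pulls (k : 'I_K) n :
  Ev n (fun h => expR (- (pulls k h)%:R)) <= expR (- (explore_mass n / 2)).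
Proof.
elim: n => [|n IH]; first by rewrite Ev0 /pulls /explore_mass big_ord0 mul0r.
rewrite /explore_mass big_ord_recr /= -/(explore_mass n).
set p := _ / K%:R.
apply: (@le_trans _ _ (expR (- (p / 2)) * Ev n (fun h => expR (- (pulls k h)%:R)))).
  rewrite -EvZ; apply: Ev_S_le => h sh.
  set e := expR (- _%:R).
  apply: le_trans (step_local (F := fun _ _ j =>
     e * (if j == k then 2^-1 else 1)) _) _.
    move=> s; rewrite pulls_rcons natrD opprD expRD -/e ler_wpM2l ?expR_ge0//.
    case: eqP => _ /=; last by rewrite oppr0 expR0.
    by rewrite expRN lef_pV2 ?posrE ?expR_gt0// (le_trans _ (expR_ge1Dx _))//; lra.
  have E j : \sum_(a : bool) bern lam a * (\sum_(b : bool) bern (mu j) b *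
     (e * (if j == k then 2^-1 else 1))) = e * (if j == k then 2^-1 else 1).
    by rewrite !big_bool /bern /=; lra.
  under eq_bigr do rewrite E mulrCA.
  rewrite -mulr_sumr mulrC ler_wpM2r ?expR_ge0// (bigD1 k)//= eqxx.
  under eq_bigr => j /negbTE -> do rewrite mulr1.
  have := sum_sched_prob_le1 (size h).+1 h; rewrite (bigD1 k)//=.
  have := sched_prob_ge (size h).+1 h k; rewrite sh -/p => pq sq.
  apply: le_trans (expR_ge1Dx _); lra.
rewrite mulrDl opprD expRD mulrC.
by rewrite ler_wpM2r ?expR_ge0.
Qed.

Definition concentrated (m x : R) h : bool :=
  [forall k : 'I_K, (m <= (pulls k h)%:R) &&
    (`|(successes k h)%:R - mu k * (pulls k h)%:R| <= x * (pulls k h)%:R)].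

(** Union bound over the servers and Chernoff bounds for three failures: too few pulls by time [m0],
    and a deviation in either direction. *)
Lemma Ev_not_concentrated (m x : R) (m0 n : nat) : 0 < x <= 2^-1 ->
  (m0 <= n)%N ->
  Ev n (fun h => (~~ concentrated m x h)%:R) <=
  K%:R * (expR (m - explore_mass m0 / 2) + 2 * expR (- (x ^+ 2 / 4 * m))).
Proof.
move=> /andP[x0 x1] sn.
pose G th k h := expR (th * ((successes k h)%:R - mu k * (pulls k h)%:R)
                       - th ^+ 2 * (pulls k h)%:R).
pose c := expR (- (x ^+ 2 / 4 * m)).
(* [th = x / 2] maximizes [th x - th ^ 2], with value [x ^ 2 / 4]; given at least [m] pulls, a
   deviation thus makes a term [c * G] at least 1. *)
pose H (k : 'I_K) h := expR m * expR (- (pulls k (take m0 h))%:R) +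
   (c * G (x / 2) k h + c * G (- (x / 2)) k h).
have a0 k h : 0 <= expR m * expR (- (pulls k (take m0 h))%:R) :> R.
  by rewrite mulr_ge0 ?expR_ge0.
have c0 th k h : 0 <= c * G th k h by rewrite mulr_ge0 ?expR_ge0.
have H0 k h : 0 <= H k h by rewrite !addr_ge0.
apply: (@le_trans _ _ (Ev n (fun h => \sum_(k < K) H k h))).
  apply: Ev_le => h sh; case: (boolP (concentrated m x h)) => [_|] /=.
    by apply: sumr_ge0.
  rewrite negb_forall => /existsP[k]; rewrite (bigD1 k)//= => bad.
  apply: (@le_trans _ _ (H k h)); last by rewrite lerDl sumr_ge0.
  have a1 := a0 k h; have c1 := c0 (x / 2) k h; have c2 := c0 (- (x / 2)) k h.
  move: bad; rewrite negb_and -!ltNge => bad.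
  have [Tm|Tm] := ltP (pulls k h)%:R m.
    rewrite /H; suff : 1 <= expR m * expR (- (pulls k (take m0 h))%:R) by lra.
    rewrite -expRD -[leLHS]expR0 ler_expR.
    have : (pulls k (take m0 h))%:R <= (pulls k h)%:R :> R.
      by rewrite ler_nat pulls_take.
    lra.
  move: bad; rewrite ltNge Tm /= ltr_normr.
  have xm : x ^+ 2 / 4 * m <= x ^+ 2 / 4 * (pulls k h)%:R.
    by rewrite ler_wpM2l// divr_ge0 ?sqr_ge0.
  set S := _ - _; set T := (pulls k h)%:R => /orP[] dev.
    rewrite /H; suff : 1 <= c * G (x / 2) k h by lra.
    rewrite /c /G -expRD -[leLHS]expR0 ler_expR -/S -/T.
    have := ler_wpM2l (ltW x0) (ltW dev); rewrite -/T in xm; lra.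
  rewrite /H; suff : 1 <= c * G (- (x / 2)) k h by lra.
  rewrite /c /G -expRD -[leLHS]expR0 ler_expR -/S -/T.
  have := ler_wpM2l (ltW x0) (ltW dev); rewrite -/T in xm; lra.
rewrite Ev_sum mulr_natl -[in leRHS](card_ord K) -sumr_const.
apply: ler_sum => k _; rewrite !EvD !EvZ; apply: lerD.
  rewrite expRD ler_wpM2l ?expR_ge0//.
  apply: le_trans (Ev_pulls k m0).
  by apply: (Ev_take (f := fun h => expR (- (pulls k h)%:R))) => // h; exact: expR_ge0.
have x3 : `|x / 2| <= 3^-1 by rewrite ger0_norm; lra.
have h1 := @Ev_deviation k (x / 2) n x3.
have := @Ev_deviation k (- (x / 2)) n; rewrite normrN => /(_ x3) h2.
have cc : 0 <= c by exact: expR_ge0.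
have := ler_wpM2l cc h1; have := ler_wpM2l cc h2; rewrite -/c; lra.
Qed.

End process.

(** * Decomposition of the regret *)

(** Variation of constants: the initial value is propagated from [m0], and each unit injected at a
    time [j + 1 < u] is propagated from there. *)
Lemma affine_recurrence {R : realType} (y g : nat -> R) (A : R) (m0 u : nat) :
  y m0 <= A ->
  (forall r, (m0 <= r)%N -> y r.+1 <= expR (g r) * y r + (r.+1 < u)%N%:R) ->
  forall n, (m0 <= n)%N ->
  y n <= expR (\sum_(m0 <= i < n) g i) * A +
    \sum_(m0 <= j < n | (j.+1 < u)%N) expR (\sum_(j.+1 <= i < n) g i).
Proof.
move=> yA rec n; elim: n => [|n IH].
  by rewrite leqn0 => /eqP E; rewrite E in yA *; rewrite !big_geq// expR0 mul1r addr0.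
rewrite leq_eqVlt => /predU1P[E|]; first by rewrite -E !big_geq// expR0 mul1r addr0.
rewrite ltnS => mn; apply: le_trans (rec _ mn) _.
rewrite big_nat_recr//= expRD.
have -> : \sum_(m0 <= j < n.+1 | (j.+1 < u)%N) expR (\sum_(j.+1 <= i < n.+1) g i) =
  expR (g n) * (\sum_(m0 <= j < n | (j.+1 < u)%N) expR (\sum_(j.+1 <= i < n) g i))
  + (n.+1 < u)%N%:R.
  rewrite big_mkcond big_nat_recr//= (big_geq (leqnn n.+1)) expR0; congr (_ + _).
    rewrite mulr_sumr [RHS]big_mkcond big_nat_cond [RHS]big_nat_cond; apply: eq_bigr => j.
    move=> /andP[/andP[_ jn] _]; case: ifP; rewrite ?mulr0// => _.
    by rewrite big_nat_recr//= expRD mulrC.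
  by case: ifP.
rewrite addrA lerD2r.
have := ler_wpM2l (expR_ge0 (g n)) (IH mn); lra.
Qed.

Section regret.
Context {R : realType} {K : nat}.
Variables (lam : R) (mu : 'I_K -> R) (kstar : 'I_K) (D : R).
Hypotheses (lam01 : 0 <= lam <= 1) (mu01 : forall k, 0 <= mu k <= 1).
Hypotheses (D_gt0 : 0 < D) (gapD : forall k, k != kstar -> mu k <= mu kstar - D).
Hypothesis lt_lam : lam < mu kstar.
Implicit Types (h : seq (Slot K)) (s : Slot K).

Local Notation q h k := (qths_sched_prob (size h).+1 h k : R).
Local Notation Ev := (Ev lam mu).
Local Notation step := (step lam mu).
Local Notation eps := (mu kstar - lam).

Let K_gt0 : (0 < K)%N. Proof. exact: leq_ltn_trans (ltn_ord kstar). Qed.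

(** Either tail in [ts_prob_tail], for [d = D / 8] and [m] pulls. *)
Definition ts_error (m : R) : R := expR (D / 8 - (D / 8) ^+ 2 * m).

Lemma ts_prob_concentrated m h k : k != kstar ->
  concentrated mu m (D / 4) h -> ts_prob h k <= 2 * ts_error m.
Proof.
move=> kk /forallP conc; have D0 := D_gt0.
have /andP[mk] := conc k; have /andP[ms] := conc kstar.
rewrite !ler_norml => /andP[cs1 cs2] /andP[ck1 ck2].
have /andP[muk0 muk1] := mu01 k; have /andP[mus0 mus1] := mu01 kstar.
have gk := gapD kk.
have D8 : 0 < D / 8 by lra.
have Tk0 : 0 <= (pulls k h)%:R :> R by [].
(* The threshold lies midway between [mu kstar - D] and [mu kstar]. Concentration within [D / 4]
   leaves a margin [D / 4 = 2 d] on each side. *)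
apply: le_trans (ts_prob_tail (k' := kstar) (y := mu kstar - D / 2) (d := D / 8)
  _ _ _ _ _) _ => //.
- by rewrite eq_sym.
- by lra.
- rewrite -/(pulls k h).
  have := ler_wpM2r Tk0 gk; lra.
- rewrite -/(pulls kstar h).
  have : (failures kstar h)%:R = (pulls kstar h)%:R - (successes kstar h)%:R :> R.
    by rewrite /pulls natrD; lra.
  lra.
- have D80 : 0 <= (D / 8) ^+ 2 by rewrite sqr_ge0.
  rewrite /ts_error mulr_natl mulr2n -/(pulls k h) -/(pulls kstar h).
  by apply: lerD; rewrite ler_expR lerD2l lerN2 ler_wpM2l.
Qed.

(** Bounds the probability of a wrong server in slot [r + 1], given a concentrated history of length
    [r]. *)
Definition wrong_rate (m : R) (r : nat) : R :=
  explore_prob K r.+1 + 2 * K%:R * ts_error m.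

Lemma wrong_rate_ge0 m r : 0 <= wrong_rate m r.
Proof.
have /andP[e0 _] := @explore_prob01 R K r.+1.
by rewrite addr_ge0// !mulr_ge0// expR_ge0.
Qed.

Lemma sum_sched_wrong m h : concentrated mu m (D / 4) h ->
  \sum_(k < K | k != kstar) q h k <= wrong_rate m (size h).
Proof.
move=> conc; have /andP[e0 e1] := @explore_prob01 R K (size h).+1.
have eta0 : 0 <= 2 * ts_error m by rewrite mulr_ge0// expR_ge0.
rewrite /qths_sched_prob big_split /=; apply: lerD.
  apply: (@le_trans _ _ (\sum_(k < K) explore_prob K (size h).+1 / K%:R)).
    by rewrite [leRHS](bigID (fun k => k != kstar))/= lerDl sumr_ge0// => k _;
      rewrite divr_ge0.
  by rewrite sumr_const card_ord -[_ *+ _]mulr_natr divfK// pnatr_eq0 -lt0n.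
apply: (@le_trans _ _ (\sum_(k < K) 2 * ts_error m)); last first.
  by rewrite sumr_const card_ord -[_ *+ _]mulr_natl; lra.
apply: (@le_trans _ _ (\sum_(k < K | k != kstar) 2 * ts_error m)).
  apply: ler_sum => k kk; apply: le_trans (ts_prob_concentrated kk conc).
  by rewrite ler_piMl ?ts_prob_ge0//; lra.
by rewrite [leRHS](bigID (fun k => k != kstar))/= lerDl sumr_ge0.
Qed.

(** * Coupling with the genie queue, and killed paths *)

Lemma queue_rcons q0 h s :
  queue q0 (rcons h s) = (queue q0 h + arr s - serv s (sched s))%N.
Proof. by rewrite /queue foldl_rcons. Qed.

Lemma queue_le q0 h : (queue q0 h <= q0 + size h)%N.
Proof.
elim/last_ind: h => [|h s IH]; first by rewrite addn0.
rewrite queue_rcons size_rcons; case: (arr s) (serv s (sched s)) => [] [] /=; lia.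
Qed.

Definition wrong (h : seq (Slot K)) : nat := count (fun s => sched s != kstar) h.

(** The queues share arrivals. A slot that schedules [kstar] preserves the bound on their
    difference, and any other slot raises it by at most one. *)
Lemma queue_genie_wrong a b d h : (a <= b + d)%N ->
  (queue a h <= genie_queue kstar b h + d + wrong h)%N.
Proof.
elim: h a b d => [|s h IH] a b d abd; first by rewrite addn0.
rewrite /queue /genie_queue /wrong /= -/(queue _ h) -/(genie_queue _ _ h) -/(wrong h).
have [->|ks] /= := eqVneq (sched s) kstar.
  by apply: IH; case: (arr s) (serv s kstar) => [] [] /=; lia.
rewrite add1n addnS -addSn -addnS; apply: IH.
by case: (arr s) (serv s kstar) (serv s (sched s)) => [] [] [] /=; lia.
Qed.

Definition nohit (u q0 : nat) h : bool :=
  all (fun r => (r < u)%N || (0 < queue q0 (take r h))%N) (iota 0 (size h).+1).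

(** Only lengths strictly below [size h] are tested: these are the histories on which a scheduling
    decision has already been based. *)
Definition good_past (m : R) (m0 : nat) h : bool :=
  all (fun r => (r < m0)%N || concentrated mu m (D / 4) (take r h))
    (iota 0 (size h)).

Lemma all_iota_take_rcons (P : nat -> seq (Slot K) -> bool) n h s :
  (n <= (size h).+1)%N ->
  all (fun r => P r (take r (rcons h s))) (iota 0 n) =
  all (fun r => P r (take r h)) (iota 0 n).
Proof.
move=> nh; apply: eq_in_all => r; rewrite mem_iota add0n /= => rn.
by rewrite -cats1 takel_cat// -ltnS (leq_trans rn).
Qed.

Lemma nohit_rcons u q0 h s : nohit u q0 (rcons h s) =
  nohit u q0 h && (((size h).+1 < u)%N || (0 < queue q0 (rcons h s))%N).
Proof.
rewrite /nohit size_rcons.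
have -> : iota 0 (size h).+2 = iota 0 (size h).+1 ++ [:: (size h).+1].
  by rewrite -addn1 iotaD.
rewrite all_cat (all_iota_take_rcons (fun r h => (r < u)%N || (0 < queue q0 h)%N))//.
by congr (_ && _); rewrite /= andbT take_oversize ?size_rcons.
Qed.

Lemma good_past_rcons m m0 h s : good_past m m0 (rcons h s) =
  good_past m m0 h && ((size h < m0)%N || concentrated mu m (D / 4) h).
Proof.
rewrite /good_past size_rcons.
have -> : iota 0 (size h).+1 = iota 0 (size h) ++ [:: size h].
  by rewrite -addn1 iotaD.
rewrite all_cat (all_iota_take_rcons
  (fun r h => (r < m0)%N || concentrated mu m (D / 4) h))//.
by congr (_ && _); rewrite /= andbT -cats1 take_size_cat.
Qed.

(* The path is killed when the queue is empty at a time in [u, size h] or when a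
   past history from time m0 on is not concentrated. *)
Definition surviving (th m : R) (m0 u q0 : nat) h : R :=
  (nohit u q0 h && good_past m m0 h)%:R * expR (th * (queue q0 h)%:R).

(** Multiplicative drift of the exponential weight. The indicator on the right pays for paths whose
    queue empties before [u]: they survive with weight 1. *)
Lemma step_surviving th m m0 u q0 h : 0 < th <= 3^-1 -> (m0 <= size h)%N ->
  step (surviving th m m0 u q0) h <=
  expR (- (th * eps) + th ^+ 2 + th * wrong_rate m (size h)) *
    surviving th m m0 u q0 h + ((size h).+1 < u)%N%:R.
Proof.
move=> /andP[th0 th3] m0h.
have /andP[l0 l1] := lam01; have /andP[mus0 mus1] := mu01 kstar; have ll := lt_lam.
have Y0 h' : 0 <= surviving th m m0 u q0 h' by rewrite mulr_ge0 ?expR_ge0.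
have rhs0 : 0 <= expR (- (th * eps) + th ^+ 2 + th * wrong_rate m (size h)) *
    surviving th m m0 u q0 h + ((size h).+1 < u)%N%:R.
  by rewrite addr_ge0// mulr_ge0// expR_ge0.
have [/andP[nh /andP[gh conc]]|bad] :=
    boolP (nohit u q0 h && (good_past m m0 h && concentrated mu m (D / 4) h)); last first.
  (* A killed path stays killed, and a history that is not concentrated kills all its extensions, so
     the new weight is 0. *)
  apply: le_trans rhs0; apply: le_trans (step_cst_le K_gt0 lam01 mu01 h (lexx 0)).
  apply: (step_le lam01 mu01) => s; rewrite /surviving nohit_rcons good_past_rcons.
  rewrite (ltnNge (size h) m0) m0h orFb; move: bad.
  case: (nohit u q0 h) (good_past m m0 h) (concentrated _ _ _ h) => [] [] []//= _;
    by rewrite ?andbF mul0r.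
set Q : R := (queue q0 h)%:R; set c : R := ((size h).+1 < u)%N%:R.
have c0 : 0 <= c by [].
apply: le_trans (step_local lam01 mu01 (F := fun a b _ =>
   expR (th * Q) * (1 + th * (a%:R - b%:R) + th ^+ 2) + c) _) _.
  move=> s; set a : R := (arr s)%:R; set b : R := (serv s (sched s))%:R.
  have abE : expR (th * (Q + a - b)) <= expR (th * Q) * (1 + th * (a - b) + th ^+ 2).
    rewrite -addrA mulrDr expRD ler_wpM2l ?expR_ge0//.
    have ab : `|a - b| <= 1.
      by rewrite /a /b; case: (arr s) (serv s (sched s)) => [] [] /=;
        rewrite ?subrr ?subr0 ?sub0r ?normrN ?normr0 ?normr1.
    apply: le_trans (expR_le_quadratic _) _.
      by rewrite normrM (gtr0_norm th0) (le_trans _ th3)// ler_piMr// ltW.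
    by rewrite lerD2l exprMn ler_piMr ?sqr_ge0// -real_normK ?num_real// expr_le1.
  apply: le_trans (_ : _ <= expR (th * (Q + a - b)) + c) _; last by rewrite lerD2r.
  rewrite /surviving nohit_rcons good_past_rcons nh gh conc orbT /= andbT.
  (* If the new queue is positive, the truncation at 0 was inactive; if it is 0, the weight is 1
     before [u] and 0 from [u] on. *)
  have [pos|] := boolP (0 < queue q0 (rcons h s))%N.
    rewrite orbT mul1r.
    have -> : (queue q0 (rcons h s))%:R = Q + a - b.
      move: pos; rewrite queue_rcons /Q /a /b => pos.
      by rewrite natrB ?natrD//; move: pos; rewrite subn_gt0 => /ltnW.
    by rewrite lerDl.
  rewrite -eqn0Ngt => /eqP ->; rewrite mulr0 expR0 mulr1 orbF -/c.
  by rewrite lerDr expR_ge0.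
have E k : \sum_(a : bool) bern lam a * (\sum_(b : bool) bern (mu k) b *
   (expR (th * Q) * (1 + th * (a%:R - b%:R) + th ^+ 2) + c)) =
   expR (th * Q) * (1 + th * (lam - mu k) + th ^+ 2) + c.
  by rewrite !big_bool /bern /=; ring.
under eq_bigr do rewrite E.
set e := expR (th * Q); have e0 : 0 <= e by exact: expR_ge0.
have Sq := sum_sched_prob_le1 (R := R) K_gt0 (size h).+1 h.
have Sw := sum_sched_wrong conc.
have -> : surviving th m m0 u q0 h = e by rewrite /surviving nh gh mul1r.
set B := 1 - th * eps + th ^+ 2.
have B0 : 0 <= B.
  have : th * eps <= 1 * 1 by apply: ler_pM; lra.
  by have := sqr_ge0 th; rewrite /B; lra.
(* Every server is given the drift of [kstar]; a wrong one costs at most [th] more, since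
   [mu kstar - mu k <= 1]. *)
apply: (@le_trans _ _ (\sum_k q h k * (e * B + c) + \sum_(k < K | k != kstar) q h k * (e * th))).
  rewrite [X in _ <= _ + X]big_mkcond -big_split /=; apply: ler_sum => k _.
  have q0' : 0 <= q h k by exact: sched_prob_ge0.
  case: eqVneq => [->|kk] /=; first by rewrite addr0 ler_wpM2l ?sched_prob_ge0// /B; lra.
  rewrite -mulrDr ler_wpM2l//.
  have /andP[muk0 muk1] := mu01 k.
  have : e * (th * (1 - (mu kstar - mu k))) >= 0.
    by apply: mulr_ge0 => //; apply: mulr_ge0; [exact: ltW|lra].
  rewrite /B; lra.
rewrite -!mulr_suml.
apply: (@le_trans _ _ (e * B + c + wrong_rate m (size h) * (e * th))).
  apply: lerD; first by rewrite ler_piMl// addr_ge0// mulr_ge0.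
  by rewrite ler_wpM2r// mulr_ge0// ltW.
have : e * (1 + (- (th * eps) + th ^+ 2 + th * wrong_rate m (size h))) <=
   e * expR (- (th * eps) + th ^+ 2 + th * wrong_rate m (size h)).
  by rewrite ler_wpM2l// expR_ge1Dx.
rewrite /B; lra.
Qed.

Lemma Ev_surviving_base th m m0 u q0 : 0 < th ->
  Ev m0 (surviving th m m0 u q0) <= expR (th * (q0 + m0)%:R).
Proof.
move=> th0; apply: le_trans (Ev_cst_le K_gt0 lam01 mu01 m0 (expR_ge0 _)).
apply: (Ev_le lam01 mu01) => h sh; rewrite /surviving.
apply: (@le_trans _ _ (expR (th * (queue q0 h)%:R))).
  by rewrite ler_piMl ?expR_ge0// lern1 leq_b1.
by rewrite ler_expR ler_pM2l// ler_nat -sh queue_le.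
Qed.

(** * Expected number of late wrong slots, and the regret for given parameters *)

Definition late_wrong (u : nat) h : R := (wrong (drop u h))%:R.

Definition bad_bound (m : R) (m0 : nat) : R :=
  K%:R * (expR (m - @explore_mass R K m0 / 2) + 2 * expR (- ((D / 4) ^+ 2 / 4 * m))).

Lemma bad_bound_ge0 m m0 : 0 <= bad_bound m m0.
Proof. by rewrite mulr_ge0// addr_ge0 ?mulr_ge0 ?expR_ge0. Qed.

Lemma Ev_bad m m0 n : D <= 1 -> (m0 <= n)%N ->
  Ev n (fun h => (~~ concentrated mu m (D / 4) h)%:R) <= bad_bound m m0.
Proof.
by move=> D1 mn; have D0 := D_gt0; apply: Ev_not_concentrated => //; lra.
Qed.

(** Each slot after [u] is charged [wrong_rate] on a concentrated history and 1 on any other, the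
    latter with total weight at most [bad_bound]. *)
Lemma Ev_late_wrong m m0 u n : D <= 1 -> (m0 <= u)%N ->
  Ev n (late_wrong u) <=
  \sum_(u <= r < n) (wrong_rate m r + bad_bound m m0).
Proof.
move=> D1 mu0; elim: n => [|n IH].
  by rewrite Ev0 /late_wrong /= big_geq//.
have [un|nu] := leqP u n; last first.
  rewrite big_geq//; apply: le_trans (Ev_cst_le K_gt0 lam01 mu01 n.+1 (lexx 0)).
  by apply: (Ev_le lam01 mu01) => h sh; rewrite /late_wrong drop_oversize ?sh.
rewrite big_nat_recr//=.
apply: (@le_trans _ _ (Ev n (fun h => late_wrong u h + (wrong_rate m n +
    (~~ concentrated mu m (D / 4) h)%:R)))).
  apply: (Ev_S_le lam01 mu01) => h sh.
  apply: le_trans (step_local lam01 mu01 (F := fun _ _ k =>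
     late_wrong u h + (k != kstar)%:R) _) _.
    move=> s; rewrite /late_wrong -cats1 drop_cat sh.
    have [E|E] := ltnP n u; first by move: un; rewrite leqNgt E.
    have [lt|ge] := ltnP u n.
      by rewrite /wrong count_cat /= addn0 natrD.
    have -> : u = n by apply/eqP; rewrite eqn_leq un ge.
    by rewrite subnn /wrong drop0 /= addn0 drop_oversize ?sh// add0r.
  have E k : \sum_(a : bool) bern lam a * (\sum_(b : bool) bern (mu k) b *
     (late_wrong u h + (k != kstar)%:R)) = late_wrong u h + (k != kstar)%:R.
    by rewrite !big_bool /bern /=; ring.
  under eq_bigr do rewrite E mulrDr.
  rewrite big_split /= -mulr_suml; apply: lerD.
    by rewrite ler_piMl// sum_sched_prob_le1.
  have -> : \sum_(i < K) q h i * (i != kstar)%:R = \sum_(i < K | i != kstar) q h i.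
    by rewrite [RHS]big_mkcond; apply: eq_bigr => i _; case: ifP; rewrite ?mulr1 ?mulr0.
  have [conc|_] := boolP (concentrated _ _ _ h).
    by rewrite addr0 -sh sum_sched_wrong.
  apply: (@le_trans _ _ 1); last by rewrite lerDr wrong_rate_ge0.
  apply: le_trans (sum_sched_prob_le1 (R := R) K_gt0 (size h).+1 h).
  rewrite [leRHS](bigID (fun k => k != kstar))/= lerDl sumr_ge0// => k _.
  exact: sched_prob_ge0.
rewrite EvD; apply: lerD => //; rewrite EvD; apply: lerD.
  by apply: Ev_cst_le => //; exact: wrong_rate_ge0.
by apply: Ev_bad => //; exact: leq_trans un.
Qed.

(** Union bound over the lengths in [m0, n), each reduced by [Ev_take] to an expectation at its own
    time. *)
Lemma Ev_not_good_past m m0 n : D <= 1 ->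
  Ev n (fun h => (~~ good_past m m0 h)%:R) <= n%:R * bad_bound m m0.
Proof.
move=> D1.
apply: (@le_trans _ _ (Ev n (fun h =>
   \sum_(m0 <= r < n) (~~ concentrated mu m (D / 4) (take r h))%:R))).
  apply: (Ev_le lam01 mu01) => h sh.
  have [_|] := boolP (good_past m m0 h); first by rewrite sumr_ge0.
  rewrite /good_past -has_predC => /hasP[r]; rewrite mem_iota sh add0n /=.
  rewrite negb_or -leqNgt => rn /andP[mr bad].
  by rewrite (big_rem r) ?mem_index_iota ?mr//= bad lerDl sumr_ge0.
rewrite Ev_sum; apply: (@le_trans _ _ (\sum_(m0 <= r < n) bad_bound m m0)).
  rewrite big_nat_cond [leRHS]big_nat_cond; apply: ler_sum => r /andP[/andP[mr rn] _].
  apply: le_trans (Ev_bad m D1 mr).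
  apply: (Ev_take K_gt0 lam01 mu01
     (f := fun h => (~~ concentrated mu m (D / 4) h)%:R)) => //.
  exact: ltnW.
rewrite sumr_const_nat -[leLHS]mulr_natl ler_wpM2r ?bad_bound_ge0//.
by rewrite ler_nat leq_subr.
Qed.

(** At [th = 0], [surviving] is an indicator. A path outside the two rare events has an empty queue
    at some time from [u] on, after which only wrong slots count; on the rare events the regret is
    at most the number of slots. *)
Lemma regret_pathwise m m0 u q0 h : (u <= size h)%N ->
  (queue q0 h)%:R - (genie_queue kstar q0 h)%:R <=
  late_wrong u h + (size h)%:R * surviving 0 m m0 u q0 h +
  (size h)%:R * (~~ good_past m m0 h)%:R.
Proof.
move=> uh; rewrite /surviving mul0r expR0 mulr1 lerBlDl.
have [|] := boolP (nohit u q0 h).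
  move=> _ /=.
  have := @queue_genie_wrong q0 q0 0 h; rewrite addn0 => /(_ (leqnn _)) H.
  have H2 : (queue q0 h <= genie_queue kstar q0 h + size h)%N.
    by apply: leq_trans H _; rewrite addn0 leq_add2l count_size.
  have : (queue q0 h)%:R <= (genie_queue kstar q0 h)%:R + (size h)%:R :> R.
    by rewrite -natrD ler_nat.
  have : 0 <= late_wrong u h by rewrite /late_wrong.
  by case: (good_past _ _ _) => /=; lra.
rewrite /nohit -has_predC => /hasP[r]; rewrite mem_iota add0n /= ltnS => rh.
rewrite negb_or -leqNgt -eqn0Ngt => /andP[ur /eqP hit] /=.
(* At the hitting time [r] the queue is not above the genie queue, and the wrong slots after [r] are
   among those after [u]. *)
have E : (queue q0 h <= genie_queue kstar q0 h + wrong (drop u h))%N.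
  rewrite -{1 2}(cat_take_drop r h) /queue /genie_queue !foldl_cat.
  rewrite -/(queue q0 _) hit -/(queue 0 _) -/(genie_queue _ q0 _).
  rewrite -/(genie_queue _ (genie_queue _ _ _) _).
  have := @queue_genie_wrong 0 (genie_queue kstar q0 (take r h)) 0 (drop r h).
  rewrite !addn0 => /(_ (leq0n _))/leq_trans; apply; rewrite leq_add2l.
  rewrite -(subnK ur) -drop_drop /wrong -{2}(cat_take_drop (r - u) (drop u h)).
  by rewrite count_cat leq_addl.
have : (queue q0 h)%:R <= (genie_queue kstar q0 h)%:R + late_wrong u h :> R.
  by rewrite -natrD ler_nat.
have : 0 <= (size h)%:R * (~~ good_past m m0 h)%:R :> R by [].
lra.
Qed.

Definition drift (th m : R) (r : nat) : R :=
  - (th * eps) + th ^+ 2 + th * wrong_rate m r.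

(** For [th > 0] the exponential weight is at least 1 on surviving paths, so the recurrence for [th]
    bounds their probability. *)
Lemma Ev_surviving th m m0 u q0 n : 0 < th <= 3^-1 -> (m0 <= n)%N ->
  Ev n (surviving 0 m m0 u q0) <=
  expR (\sum_(m0 <= i < n) drift th m i) * expR (th * (q0 + m0)%:R) +
    \sum_(m0 <= j < n | (j.+1 < u)%N) expR (\sum_(j.+1 <= i < n) drift th m i).
Proof.
move=> th03 mn; have /andP[th0 _] := th03.
apply: (@le_trans _ _ (Ev n (surviving th m m0 u q0))).
  apply: (Ev_le lam01 mu01) => h _; rewrite /surviving ler_wpM2l// ler_expR mul0r.
  by rewrite mulr_ge0// ltW.
apply: (@affine_recurrence R (fun n => Ev n (surviving th m m0 u q0))) => //.
  exact: Ev_surviving_base.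
move=> r mr; rewrite Ev_S -EvZ.
apply: (@le_trans _ _ (Ev r (fun h => expR (drift th m r) * surviving th m m0 u q0 h +
   (r.+1 < u)%N%:R))).
  by apply: (Ev_le lam01 mu01) => h sh; rewrite -sh step_surviving// sh.
by rewrite EvD lerD2l; apply: Ev_cst_le.
Qed.

Lemma Ev_regret th m m0 u q0 t : D <= 1 -> 0 < th <= 3^-1 ->
  (m0 <= u)%N -> (u <= t)%N ->
  Ev t (fun h => (queue q0 h)%:R - (genie_queue kstar q0 h)%:R) <=
  \sum_(u <= r < t) (wrong_rate m r + bad_bound m m0) +
  t%:R * (expR (\sum_(m0 <= i < t) drift th m i) * expR (th * (q0 + m0)%:R) +
    \sum_(m0 <= j < t | (j.+1 < u)%N) expR (\sum_(j.+1 <= i < t) drift th m i)) +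
  t%:R * (t%:R * bad_bound m m0).
Proof.
move=> D1 th03 mu0 ut.
apply: (@le_trans _ _ (Ev t (fun h => late_wrong u h +
   t%:R * surviving 0 m m0 u q0 h + t%:R * (~~ good_past m m0 h)%:R))).
  apply: (Ev_le lam01 mu01) => h sh; rewrite -sh; apply: regret_pathwise.
  by rewrite sh.
rewrite !EvD !EvZ; apply: lerD; first apply: lerD.
- exact: Ev_late_wrong.
- by rewrite ler_wpM2l// Ev_surviving// (leq_trans mu0).
- by rewrite ler_wpM2l// Ev_not_good_past.
Qed.

(** Serves for the initial queues that are too long for the sharp estimate. *)
Lemma Ev_regret_trivial q0 t :
  Ev t (fun h => (queue q0 h)%:R - (genie_queue kstar q0 h)%:R) <= t%:R.
Proof.
apply: le_trans (Ev_cst_le K_gt0 lam01 mu01 t (ler0n _ t)).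
apply: (Ev_le lam01 mu01) => h sh; rewrite lerBlDl -natrD ler_nat.
apply: leq_trans (queue_genie_wrong (b := q0) (d := 0) h _) _.
  by rewrite addn0.
by rewrite addn0 leq_add2l -sh count_size.
Qed.

End regret.

(** * Numerical estimates *)

Section numerics.
Context {R : realType}.

(** Each term is at most [ln (b + 1) - ln b], by [ln (1 - x) <= - x] at [x = 1 / (b + 1)]. *)
Lemma sum_harmonic_le (a b : nat) : (0 < a)%N -> (a <= b)%N ->
  \sum_(a <= i < b) (i.+1%:R : R)^-1 <= ln (b%:R : R) - ln a%:R.
Proof.
move=> a0; elim: b => [|b IH]; first by rewrite leqn0 => /eqP ->; rewrite big_geq// subrr.
rewrite leq_eqVlt => /predU1P[->|]; first by rewrite big_geq// subrr.
rewrite ltnS => ab; rewrite big_nat_recr//=.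
have b0 : 0 < b%:R :> R by rewrite ltr0n (leq_trans a0).
have b1 : 0 < b.+1%:R :> R by rewrite ltr0n.
suff h : (b.+1%:R : R)^-1 <= ln b.+1%:R - ln b%:R.
  by apply: le_trans (lerD (IH ab) h) _; rewrite addrC addrA subrK.
have : ln (1 + (- b.+1%:R^-1)) <= - b.+1%:R^-1 :> R.
  by apply: le_ln1Dx; rewrite ltrN2 invf_lt1// ltr1n ltnS -(ltr0n R).
have -> : 1 + (- b.+1%:R^-1) = b%:R / b.+1%:R :> R.
  by rewrite -natr1; field; rewrite natr1 gt_eqF.
by rewrite ln_div ?posrE// => h; rewrite -lerN2 opprB.
Qed.

(** Gathers every requirement that [t] be large; the threshold depends on [D] and [P0] alone. With
    [a = L ^ (1 / 3)], [ln w >= a ^ 2], so [w] outgrows [L ^ 3 = a ^ 9] and [(ln w) ^ 2] outgrows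
    [L = a ^ 3]. *)
Lemma wfun_asymptotics (D P0 : R) : 0 < D <= 1 -> 0 <= P0 ->
  exists t0 : nat, forall t : nat, (t0 < t)%N ->
    [/\ 100 <= ln (t%:R : R), 30 * ln (t%:R : R) ^+ 3 + 30 <= wfun D t,
        P0 * ln (t%:R : R) <= wfun D t / 4, 2 <= ln (wfun D t)
      & P0 * ln (t%:R : R) <= 3 / 2 * (ln (wfun D t) - 1) ^+ 2].
Proof.
move=> /andP[D0 D1] P00; pose a0 : R := 60 * 120 + 4 * 120 * P0.
exists (Num.truncn (expR (a0 ^+ 3))) => t tt0.
have a00 : 60 * 120 <= a0 by rewrite /a0; lra.
have T0 : 0 < t%:R :> R by rewrite ltr0n (leq_ltn_trans _ tt0).
set L := ln t%:R.
have LL : a0 ^+ 3 <= L.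
  rewrite -ler_expR /L lnK//; apply/ltW.
  have /andP[_ h] := truncn_itv (expR_ge0 (a0 ^+ 3)).
  by apply: lt_le_trans h _; rewrite ler_nat.
have L0 : 0 <= L by apply: le_trans LL; rewrite exprn_ge0//; lra.
pose a := L `^ (3^-1).
have aL : a ^+ 3 = L.
  by rewrite -powR_mulrn ?powR_ge0// /a -powRrM mulVf ?powRr1// pnatr_eq0.
have aa0 : a0 <= a.
  rewrite -(@ler_pXn2r _ 3)// ?nnegrE ?powR_ge0 ?aL//; lra.
have a72 : 60 * 120 <= a by lra.
have Wz : a ^+ 2 <= (2 * L / D) `^ (2 / 3).
  have -> : a ^+ 2 = L `^ (2 / 3).
    by rewrite -powR_mulrn ?powR_ge0// /a -powRrM mulrC.
  have r23 : 0 <= 2 / 3 :> R by lra.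
  apply: (ge0_ler_powR r23); rewrite ?nnegrE//.
    by rewrite !mulr_ge0// invr_ge0 ltW.
  by rewrite ler_pdivlMr//; have := ler_wpM2l L0 D1; lra.
have lnw : ln (wfun D t) = (2 * L / D) `^ (2 / 3) by rewrite /wfun expRK.
have w10 : a ^+ 10 / 120 <= wfun D t.
  apply: (@le_trans _ _ (expR (a ^+ 2))); last by rewrite ler_expR.
  (* The term of degree 5 of the exponential series gives [a ^ 10 / 5!]. *)
  have := @expR_ge1Dxn R (a ^+ 2) 4 (sqr_ge0 _).
  by rewrite -exprM (_ : 5`!%:R = 120 :> R)//; lra.
have a9 : 60 * 120 * a ^+ 9 <= a ^+ 10.
  by rewrite (exprS a 9) ler_wpM2r// exprn_ge0; lra.
have a91 : 1 <= a ^+ 9 by rewrite exprn_ege1; lra.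
have L1 : 100 <= L.
  rewrite -aL; apply: (@le_trans _ _ (a * 1)); first by lra.
  by rewrite exprS ler_wpM2l ?exprn_ege1//; lra.
split => //.
- by rewrite -aL -exprM; lra.
- have h4 : a * a ^+ 3 <= a ^+ 10.
    by rewrite -exprS ler_weXn2l//; lra.
  have : 4 * 120 * P0 * a ^+ 3 <= a * a ^+ 3.
    by rewrite ler_wpM2r ?exprn_ge0//; [lra|rewrite /a0 in aa0; lra].
  rewrite -aL; lra.
- by rewrite lnw; have : 10 * 10 <= a * a by [apply: ler_pM; lra]; rewrite -expr2; lra.
- rewrite lnw; move: Wz; set W := powR _ _ => Wz; rewrite -aL.
  have z1 : 10 * 10 <= a ^+ 2 by rewrite expr2; apply: ler_pM; lra.
  have h1 : (a ^+ 2 / 2) ^+ 2 <= (W - 1) ^+ 2.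
    by rewrite lerXn2r ?nnegrE; lra.
  have : 3 * P0 * a ^+ 3 <= a * a ^+ 3.
    by rewrite ler_wpM2r ?exprn_ge0//; [lra|rewrite /a0 in aa0; lra].
  have -> : a * a ^+ 3 = 4 * (a ^+ 2 / 2) ^+ 2 by field.
  have := sqr_ge0 (a ^+ 2 / 2); lra.
Qed.

(** Only the second half of the slots is counted. There the time is at least [w / 2], with logarithm
    at least [ln w - 1]. The two bounds on [P] match the two branches of the minimum in
    [explore_prob]. *)
Lemma explore_mass_ge (K m0 : nat) (w P : R) : (2 <= K)%N ->
  K%:R * w / 2 <= m0%:R -> 2 <= ln w -> P <= w / 4 ->
  P <= 3 / 2 * (ln w - 1) ^+ 2 -> P <= @explore_mass R K m0.
Proof.
move=> K2 Kw lw2 Pw Pl; have K0 := ltnW K2.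
have w0 : 0 < w by rewrite ltNge; apply/negP => w0; have := ln_le0 (le_trans w0 ler01); lra.
have KR : 2 <= K%:R :> R by rewrite (ler_nat _ 2).
have Kw2 : w <= K%:R * w / 2 by have := ler_wpM2r (ltW w0) KR; lra.
have m00 : 0 < m0%:R :> R by lra.
pose c : R := minr (K%:R^-1) (3 * (ln w - 1) ^+ 2 / m0%:R).
have Pc : P <= m0%:R / 2 * c.
  rewrite /c /minr; case: ifP => _.
    apply: (le_trans Pw); rewrite ler_pdivlMr ?ltr0n//; lra.
  have -> // : m0%:R / 2 * (3 * (ln w - 1) ^+ 2 / m0%:R) = 3 / 2 * (ln w - 1) ^+ 2.
  by field; rewrite gt_eqF.
apply: (le_trans Pc).
have c0 : 0 <= c.
  by rewrite /c le_min invr_ge0 ler0n /= divr_ge0// mulr_ge0// sqr_ge0.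
rewrite /explore_mass -(big_mkord xpredT (fun i => explore_prob K i.+1 / K%:R)).
have half : (m0./2 <= m0)%N by clear; lia.
rewrite (big_cat_nat (n := m0./2))//= -[X in X <= _]add0r.
apply: lerD.
  by apply: sumr_ge0 => i _; rewrite divr_ge0//; case/andP: (@explore_prob01 R K i.+1).
apply: (@le_trans _ _ (\sum_(m0./2 <= i < m0) c)).
  rewrite sumr_const_nat -[leRHS]mulr_natl ler_wpM2r// natrB//.
  have : (m0./2.*2)%:R <= m0%:R :> R by rewrite ler_nat -[leqRHS]odd_double_half leq_addl.
  by rewrite -muln2 natrM; lra.
apply: ler_sum_nat => i /andP[hi im].
have i0 : 0 < i.+1%:R :> R by rewrite ltr0n.
have im' : i.+1%:R <= m0%:R :> R by rewrite ler_nat.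
have mi : m0%:R / 2 <= i.+1%:R :> R.
  rewrite ler_pdivrMr// -natrM ler_nat muln2; move: hi; clear; lia.
have lni : ln w - 1 <= ln i.+1%:R.
  have : ln (w / 2) <= ln i.+1%:R by rewrite ler_ln ?posrE//; lra.
  rewrite ln_div ?posrE//.
  have : ln 2 <= 1 :> R by have := @le_ln1Dx R 1; rewrite (_ : 1 + 1 = 2)//; apply; lra.
  lra.
rewrite /c /explore_prob ler_pdivlMr ?ltr0n// le_min; apply/andP; split.
  apply: (@le_trans _ _ (K%:R^-1 * K%:R)).
    by rewrite ler_wpM2r// ge_min lexx.
  by rewrite mulVf// gt_eqF// ltr0n.
apply: (@le_trans _ _ (3 * (ln w - 1) ^+ 2 / m0%:R * K%:R)).
  by rewrite ler_wpM2r// ge_min lexx orbT.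
have -> : 3 * (ln w - 1) ^+ 2 / m0%:R * K%:R = 3 * K%:R * (ln w - 1) ^+ 2 / m0%:R by ring.
apply: ler_pM; rewrite ?invr_ge0//.
- by rewrite mulr_ge0 ?sqr_ge0// mulr_ge0.
- by rewrite ler_wpM2l// lerXn2r// nnegrE; lra.
- by rewrite lef_pV2.
Qed.

End numerics.

(** * Sums of the drift over a time window *)

Section drift_sums.
Context {R : realType}.
Implicit Types (wr : nat -> R) (a t : nat).

(** Each term is at most [- 2 eps ^ 2 / 9 + eps ^ 2 / 60], below [- eps ^ 2 / 8], and there are at
    least [24 L / eps ^ 2] terms. *)
Lemma sum_drift_late wr (eps L : R) a t : 0 < eps -> (a <= t)%N ->
  (forall r, (a <= r < t)%N -> wr r <= eps / 20) ->
  24 / eps ^+ 2 * L <= (t - a)%:R ->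
  \sum_(a <= i < t) (- (eps / 3 * eps) + (eps / 3) ^+ 2 + eps / 3 * wr i) <=
  - (3 * L).
Proof.
move=> e0 at_ wre Lt.
apply: (@le_trans _ _ (\sum_(a <= i < t) (- (eps ^+ 2 / 8)))).
  apply: ler_sum_nat => i ai.
  by have := ler_wpM2l (ltW e0) (wre _ ai); have := sqr_ge0 eps; lra.
rewrite sumr_const_nat -[leLHS]mulr_natl.
have e20 : 0 <= eps ^+ 2 / 8 by rewrite divr_ge0// sqr_ge0.
have := ler_wpM2l e20 Lt.
have -> : eps ^+ 2 / 8 * (24 / eps ^+ 2 * L) = 3 * L by field; rewrite gt_eqF.
lra.
Qed.

(** Here the rate may be large at single slots; only its harmonic sum is controlled. *)
Lemma sum_drift_early wr (eps c tau : R) a t : 0 < eps -> 0 <= c ->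
  (0 < a)%N -> (a <= t)%N ->
  (forall r, (a <= r < t)%N -> wr r <= c / r.+1%:R + tau) ->
  \sum_(a <= i < t) (- (eps / 3 * eps) + (eps / 3) ^+ 2 + eps / 3 * wr i) <=
  - (2 / 9 * eps ^+ 2 * (t - a)%:R) +
  eps / 3 * (c * ln (t%:R : R) + (t - a)%:R * tau).
Proof.
move=> e0 c0 a0 at_ H.
apply: (@le_trans _ _ (\sum_(a <= i < t) (- (2 / 9 * eps ^+ 2)) +
   eps / 3 * (c * \sum_(a <= i < t) i.+1%:R^-1 + \sum_(a <= i < t) tau))).
  rewrite [X in _ <= _ + _ * (X + _)]mulr_sumr -big_split /= mulr_sumr -big_split /=.
  apply: ler_sum_nat => i ai.
  have e3 : 0 <= eps / 3 by rewrite divr_ge0// ltW.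
  by have := H _ ai; move: (c / _) => z /(ler_wpM2l e3); lra.
rewrite !sumr_const_nat -[_ *+ _]mulr_natl -[tau *+ _]mulr_natl.
apply: lerD; first by lra.
apply: ler_wpM2l; first by rewrite divr_ge0// ltW.
rewrite lerD2r ler_wpM2l//.
apply: le_trans (@sum_harmonic_le R _ _ a0 at_) _.
by rewrite gerBl ln_ge0// ler1n.
Qed.

End drift_sums.

(** * Regret from a fixed initial queue *)

Section fixed_initial_queue.
Context {R : realType} {K : nat}.

(* [M] is chosen so that [M L] pulls of every server make all deviation
   probabilities of order [exp (- 6 L)]. *)
Lemma Ev_regret_bound (lam : R) (mu : 'I_K -> R) (kstar : 'I_K) (D M w : R)
    (t q0 : nat) :
  let eps := mu kstar - lam in let L := ln (t%:R : R) in
  0 <= lam <= 1 -> (forall k, 0 <= mu k <= 1) -> 0 < D <= 1 ->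
  M * (D / 8) ^+ 2 = 6 -> (forall k, k != kstar -> mu k <= mu kstar - D) ->
  lam < mu kstar -> (2 <= K)%N ->
  100 <= L -> 30 * L ^+ 3 + 30 <= w ->
  (2 * M + 12) * L <= w / 4 -> 2 <= ln w ->
  (2 * M + 12) * L <= 3 / 2 * (ln w - 1) ^+ 2 ->
  2 * L <= eps * w ->
  24 / eps ^+ 2 * L + 6 * K%:R / eps * w <= t%:R / 2 ->
  q0%:R <= 2 * L / eps ->
  Ev lam mu t (fun h => (queue q0 h)%:R - (genie_queue kstar q0 h)%:R) <=
  16 * (K%:R * (24 / eps ^+ 2 * L) * L ^+ 2 / t%:R) + 3 / t%:R.
Proof.
move=> eps L lam01 mu01 /andP[D0 D1] MD gapD ltl K2 L100 wL Pw lnw Pl Lew vt q0L.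
have /andP[l0 l1] := lam01; have /andP[mus0 mus1] := mu01 kstar.
have e0 : 0 < eps by rewrite /eps; lra.
have e1 : eps <= 1 by rewrite /eps; lra.
have L0 : 0 < L by lra.
have e3p : 0 <= eps / 3 by lra.
have e60p : 0 <= eps / 60 by lra.
have T1 : 1 < t%:R :> R by rewrite ltNge; apply/negP => /ln_le0; rewrite -/L; lra.
have T0 : 0 < t%:R :> R by lra.
have KR : 2 <= K%:R :> R by rewrite (ler_nat _ 2).
have w30 : 30 <= w by have := exprn_ge0 3 (ltW L0); lra.
have ET : t%:R = expR L by rewrite /L lnK.
have ETV : t%:R^-1 = expR (- L) by rewrite expRN ET.
have e2L : 48 * L <= eps ^+ 2 * t%:R.
  have : 24 / eps ^+ 2 * L <= t%:R / 2.
    by apply: le_trans vt; rewrite lerDl mulr_ge0 ?divr_ge0 ?mulr_ge0//; lra.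
  rewrite mulrAC ler_pdivrMr ?exprn_gt0//; lra.
pose v0 := 24 / eps ^+ 2 * L; pose v' := 6 * K%:R / eps * w.
have v0E : v0 = 24 / eps ^+ 2 * L by [].
have v'E : v' = 6 * K%:R / eps * w by [].
clearbody v0 v'; rewrite -v0E -v'E in vt; rewrite -v0E.
have v0L : 24 * L <= v0.
  rewrite v0E mulrAC ler_pdivlMr ?exprn_gt0// ler_piMr ?exprn_ile1//; lra.
have ev' : eps * v' = 6 * (K%:R * w) by rewrite v'E; field; rewrite gt_eqF.
have Kw0 : 0 <= K%:R * w by rewrite mulr_ge0//; lra.
have KwK : K%:R * 30 <= K%:R * w by rewrite ler_wpM2l.
have Kw2 : 2 * w <= K%:R * w by rewrite ler_wpM2r//; lra.
have v'K : 6 * (K%:R * w) <= v'.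
  by rewrite -ev' ler_piMl// v'E mulr_ge0 ?divr_ge0 ?mulr_ge0 ?(ltW e0)//; move: w30; clear; lra.
have Kwe : 12 * (K%:R * w) <= eps * t%:R.
  have : eps * v' <= eps * (t%:R / 2) by apply: (ler_wpM2l (ltW e0)); move: vt v0L L0; clear; lra.
  by move: ev'; clear; lra.
have KT : K%:R <= t%:R :> R by move: vt v0L L0 v'K KwK KR; clear; lra.
pose m := M * L.
(* [m0] is just above [K w / 2], late enough for [explore_mass_ge]. *)
have [m0 [m0_gt0 m0R m0R']] : exists m0 : nat,
    [/\ (0 < m0)%N, m0%:R <= K%:R * w / 2 + 1 & K%:R * w / 2 <= m0%:R].
  have h : 0 <= K%:R * w / 2 by move: Kw0; clear; lra.
  have /andP[ml mu_] := truncn_itv h.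
  exists (Num.truncn (K%:R * w / 2)).+1; split => //; last exact: ltW.
  by rewrite -natr1 lerD2r.
(* At least [v0] slots remain after [u], as [sum_drift_late] requires, and at most [v0 + 1], which
   limits the wrong slots counted. *)
have [u [ut uR1 uR2]] : exists u : nat,
    [/\ (u <= t)%N, t%:R - v0 - 1 <= u%:R & u%:R <= t%:R - v0].
  have v00 : 0 <= v0 by move: v0L L0; clear; lra.
  have /andP[ul uu] := truncn_itv v00.
  have v0t : ((Num.truncn v0).+1 <= t)%N.
    rewrite -(ler_nat R) -natr1; move: ul vt v'K KwK KR T0; move: (_%:R) => z; clear; lra.
  exists (t - (Num.truncn v0).+1)%N; split; first exact: leq_subr.
    rewrite natrB// -natr1; move: ul; move: (Num.truncn v0)%:R => z; clear; lra.
  rewrite natrB//; move: uu; move: (Num.truncn v0).+1%:R => z; clear; lra.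
have uh : t%:R / 2 <= u%:R :> R.
  by move: uR1 vt v'K KwK KR; clear; lra.
have m0u' : (m0 <= u)%N.
  by rewrite -(ler_nat R); move: uR1 m0R vt v'K KwK KR T0; clear; lra.
(* [tau = t ^ -4] bounds both the Thompson errors and [bad_bound]. Both are of order
   [K exp (- 6 L)]; one factor [exp (- L)] absorbs [K <= t], another the constants. *)
pose tau := expR (- (4 * L)).
have KexpL : K%:R * expR (- L) <= 1.
  by rewrite expRN -ET ler_pdivrMr// mul1r.
have two_e : 2 <= expR 1 :> R by have := @expR_ge1Dx R 1; clear; lra.
have ts_small : 2 * K%:R * ts_error D m <= tau.
  have -> : ts_error D m = expR (- L) * expR (D / 8 - 5 * L).
    rewrite /ts_error -expRD; congr expR.
    have -> : (D / 8) ^+ 2 * m = 6 * L by rewrite -MD /m; ring.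
    by ring.
  have : 2 * expR (D / 8 - 5 * L) <= tau.
    apply: (@le_trans _ _ (expR 1 * expR (D / 8 - 5 * L))).
      by rewrite ler_wpM2r ?expR_ge0.
    by rewrite -expRD ler_expR; move: L100 D1; clear; lra.
  by have := ler_wpM2r (expR_ge0 (D / 8 - 5 * L)) KexpL; clear; lra.
have bad_small : @bad_bound R K D m m0 <= tau.
  (* Half of the mass [(2 M + 12) L] exceeds [m = M L] by [6 L]. *)
  have Pm := explore_mass_ge K2 m0R' lnw Pw Pl.
  apply: (@le_trans _ _ (K%:R * (3 * expR (- (6 * L))))).
    rewrite /bad_bound ler_wpM2l//.
    have -> : (D / 4) ^+ 2 / 4 * m = 6 * L.
      by rewrite -MD /m; field.
    have : expR (m - @explore_mass R K m0 / 2) <= expR (- (6 * L)).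
      by rewrite ler_expR /m; move: Pm; set e := explore_mass _; clear; lra.
    by clear; lra.
  have -> : expR (- (6 * L)) = expR (- L) * expR (- (5 * L)).
    by rewrite -expRD; congr expR; clear; lra.
  have : 3 * expR (- (5 * L)) <= tau.
    apply: (@le_trans _ _ (expR 2 * expR (- (5 * L)))).
      by rewrite ler_wpM2r ?expR_ge0//; have := @expR_ge1Dx R 2; clear; lra.
    by rewrite -expRD ler_expR; move: L100; clear; lra.
  by have := ler_wpM2r (expR_ge0 (- (5 * L))) KexpL; clear; lra.
have rate r : (r < t)%N -> @wrong_rate R K D m r <= 3 * K%:R * L ^+ 2 / r.+1%:R + tau.
  move=> rt; rewrite /wrong_rate lerD// /explore_prob ge_min; apply/orP; right.
  have lr0 : 0 <= ln (r.+1%:R : R) by rewrite ln_ge0// ler1n.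
  have lrL : ln (r.+1%:R : R) <= L.
    by rewrite /L ler_ln ?posrE// ?ltr0n// ler_nat.
  have K3 : 0 <= 3 * K%:R :> R by rewrite mulr_ge0.
  have r0 : 0 <= (r.+1%:R : R)^-1 by rewrite invr_ge0.
  apply: (ler_wpM2r r0); apply: (ler_wpM2l K3).
  by rewrite lerXn2r// nnegrE ltW.
clear Pw Pl lnw two_e ts_small KexpL.
have tau_T : tau <= t%:R^-1 by rewrite ETV ler_expR; move: L0; clear; lra.
have Ttau : t%:R * tau <= 1 by rewrite ET -expRD -[leRHS]expR0 ler_expR; move: L0; clear; lra.
have tau_e : tau <= eps / 60.
  apply: (@le_trans _ _ (eps ^+ 2 / 60)).
    have h : eps ^+ 2 * t%:R * tau <= eps ^+ 2 by rewrite -mulrA ler_piMr ?sqr_ge0.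
    have : 48 * L * tau <= eps ^+ 2 * t%:R * tau by rewrite ler_wpM2r ?expR_ge0.
    have : 48 * 100 * tau <= 48 * L * tau by rewrite ler_wpM2r ?expR_ge0//; move: L100; clear; lra.
    by have := expR_ge0 (- (4 * L)); rewrite -/tau; move: h; clear; lra.
  by rewrite ler_wpM2r// expr2 ler_piMl// ltW.
have L23 : L ^+ 2 <= L ^+ 3 by rewrite (exprS L 2) ler_peMl ?sqr_ge0//; move: L100; clear; lra.
have KL3 : K%:R * (30 * L ^+ 3 + 30) <= K%:R * w by rewrite ler_wpM2l.
have KL2 : K%:R * L ^+ 2 <= K%:R * L ^+ 3 by rewrite ler_wpM2l.
have KLp : 0 <= K%:R * L ^+ 2 by rewrite mulr_ge0// sqr_ge0.
have q0w : q0%:R <= w.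
  by apply: le_trans q0L _; rewrite ler_pdivrMr// [leRHS]mulrC.
pose g r := - (eps / 3 * eps) + (eps / 3) ^+ 2 + eps / 3 * @wrong_rate R K D m r.
(* The extra summand makes room for the weight [exp (eps / 3 * (q0 + m0))] at time [m0], as
   [q0 <= w] and [m0 <= K w / 2 + 1]. *)
have early a : (m0 <= a)%N -> (a <= t)%N -> a%:R <= v' ->
    \sum_(a <= i < t) g i + eps / 3 * (w + K%:R * w / 2 + 1) <= - (3 * L).
  move=> m0a at_ av; have aR : t%:R / 2 <= (t - a)%:R :> R.
    by rewrite natrB//; move: vt av v0L L0; clear; lra.
  have h1 : \sum_(a <= i < t) g i <= - (2 / 9 * eps ^+ 2 * (t - a)%:R) +
      eps / 3 * (3 * K%:R * L ^+ 2 * L + (t - a)%:R * tau).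
    apply: sum_drift_early => //.
    - by rewrite mulr_ge0 ?sqr_ge0// mulr_ge0.
    - exact: leq_trans m0a.
    - by move=> r /andP[_ rt]; exact: rate.
  have h2 : (t - a)%:R * tau <= 1.
    apply: le_trans Ttau; rewrite ler_wpM2r ?expR_ge0// ler_nat.
    exact: leq_subr.
  have e2a : eps ^+ 2 * (t%:R / 2) <= eps ^+ 2 * (t - a)%:R.
    by rewrite ler_wpM2l// sqr_ge0.
  have h3 : eps / 3 * (3 * K%:R * L ^+ 2 * L + (t - a)%:R * tau +
      (w + K%:R * w / 2 + 1)) <= eps / 3 * (11 / 10 * (eps * t%:R / 12)).
    apply: (ler_wpM2l e3p).
    have -> : 3 * K%:R * L ^+ 2 * L = 3 * (K%:R * L ^+ 3) by ring.
    by move: h2 KL3 Kwe Kw2 KR; clear; lra.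
  by move: h1 h3 e2a e2L L0; clear; lra.
have late a : (a < u)%N -> v' <= a%:R -> \sum_(a <= i < t) g i <= - (3 * L).
  move=> au va; have at_ : (a <= t)%N by rewrite (leq_trans (ltnW au)).
  apply: sum_drift_late => //.
    move=> r /andP[ar rt]; apply: le_trans (rate r rt) _.
    suff : 3 * K%:R * L ^+ 2 / r.+1%:R <= eps / 60.
      by move: (3 * K%:R * L ^+ 2 / r.+1%:R) => z; move: tau_e e60p; clear; lra.
    rewrite ler_pdivrMr ?ltr0n//.
    (* After [v'] the exploration rate is at most [eps / 60], since [eps v' / 60 = K w / 10] and
       [w >= 30 L ^ 3 + 30]. *)
    apply: (@le_trans _ _ (eps / 60 * v')); last first.
      by apply: (ler_wpM2l e60p); rewrite (le_trans va)// ler_nat leqW.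
    have -> : eps / 60 * v' = K%:R * w / 10 by move: ev'; clear; lra.
    by move: KL3 KL2 KR; clear; lra.
  rewrite -v0E natrB//; have : a%:R <= u%:R :> R by rewrite ler_nat ltnW.
  by move: uR2; clear; lra.
have term0 : expR (\sum_(m0 <= i < t) g i) * expR (eps / 3 * (q0 + m0)%:R) <=
    expR (- (3 * L)).
  rewrite -expRD ler_expR; apply: le_trans (early m0 (leqnn _) _ _).
  - by rewrite lerD2l; apply: (ler_wpM2l e3p); rewrite natrD; move: q0w m0R; clear; lra.
  - exact: leq_trans ut.
  - by move: m0R v'K KwK KR; clear; lra.
have terms : \sum_(m0 <= j < t | (j.+1 < u)%N) expR (\sum_(j.+1 <= i < t) g i) <=
    t%:R * expR (- (3 * L)).
  apply: (@le_trans _ _ (\sum_(m0 <= j < t) expR (- (3 * L)))).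
    rewrite big_mkcond; apply: ler_sum_nat => j /andP[mj jt].
    case: ifPn => [ju|_]; last exact: expR_ge0.
    (* A busy period starting before [v'] needs the harmonic bound; a later one has a uniformly
       small rate. *)
    rewrite ler_expR; have [vj|jv] := leP v' j.+1%:R; first exact: late.
    apply: le_trans (early j.+1 (leqW mj) jt (ltW jv)).
    by rewrite lerDl mulr_ge0//; move: w30 Kw0; clear; lra.
  rewrite sumr_const_nat -[leLHS]mulr_natl ler_wpM2r ?expR_ge0// ler_nat.
  exact: leq_subr.
have e3 : 0 < eps / 3 <= 3^-1 by apply/andP; split; move: e0 e1; clear; lra.
apply: le_trans (Ev_regret lam01 mu01 D0 gapD ltl m q0 D1 e3 m0u' ut) _.
have first_sum : \sum_(u <= r < t) (@wrong_rate R K D m r + @bad_bound R K D m m0) <=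
    16 * (K%:R * v0 * L ^+ 2 / t%:R).
  (* The constant 16 is 2 * 8: at most [2 v0] slots, each costing [6 y] for exploration, as
     [r + 1 >= t / 2], and at most [y] for each of the two [tau] terms. *)
  pose y := K%:R * L ^+ 2 / t%:R.
  have y1 : t%:R^-1 <= y.
    rewrite /y -[leLHS]mul1r ler_wpM2r ?invr_ge0//.
    apply: (@le_trans _ _ (K%:R * 1)); first by move: KR; clear; lra.
    by rewrite ler_wpM2l// exprn_ege1//; move: L100; clear; lra.
  apply: (@le_trans _ _ (\sum_(u <= r < t) (8 * y))).
    apply: ler_sum_nat => r /andP[ur rt].
    have : 3 * K%:R * L ^+ 2 / r.+1%:R <= 6 * y.
      rewrite ler_pdivrMr ?ltr0n//.
      apply: (@le_trans _ _ (6 * y * (t%:R / 2))).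
        have -> : 6 * y * (t%:R / 2) = 3 * K%:R * L ^+ 2.
          by rewrite /y; field; rewrite gt_eqF.
        by [].
      rewrite ler_wpM2l//.
        by rewrite mulr_ge0// (le_trans _ y1)// invr_ge0.
      by apply: le_trans uh _; rewrite ler_nat leqW.
    have := rate r rt; move: (3 * K%:R * L ^+ 2 / r.+1%:R) => z.
    by move: tau_T y1 bad_small; clear; lra.
  rewrite sumr_const_nat -[leLHS]mulr_natl natrB//.
  have y0 : 0 <= y by apply: le_trans y1; rewrite invr_ge0 ltW.
  have -> : 16 * (K%:R * v0 * L ^+ 2 / t%:R) = 2 * v0 * (8 * y) by rewrite /y; ring.
  rewrite ler_wpM2r//; first by rewrite mulr_ge0.
  by move: uR1 v0L L100; clear; lra.
have eL : expR (- (2 * L)) <= t%:R^-1 by rewrite ETV ler_expR; move: L0; clear; lra.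
have second : t%:R * (expR (- (3 * L)) + t%:R * expR (- (3 * L))) <= 2 / t%:R.
  have -> : t%:R * (expR (- (3 * L)) + t%:R * expR (- (3 * L))) =
      expR (- (2 * L)) + expR (- L).
    rewrite mulrDr [X in _ + X]mulrCA ET -!expRD.
    by congr (expR _ + expR _); clear; lra.
  by rewrite -ETV; move: eL; clear; lra.
have third : t%:R * (t%:R * @bad_bound R K D m m0) <= t%:R^-1.
  apply: le_trans eL; apply: (@le_trans _ _ (t%:R * (t%:R * tau))).
    by rewrite !ler_wpM2l.
  by rewrite /tau ET -!expRD ler_expR; clear; lra.
have : t%:R * (expR (\sum_(m0 <= i < t) g i) * expR (eps / 3 * (q0 + m0)%:R) +
   \sum_(m0 <= j < t | (j.+1 < u)%N) expR (\sum_(j.+1 <= i < t) g i)) <=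
   t%:R * (expR (- (3 * L)) + t%:R * expR (- (3 * L))).
  by rewrite ler_wpM2l// lerD.
rewrite -/(drift lam mu kstar D (eps / 3) m) -/g; move: first_sum second third.
clear; lra.
Qed.

End fixed_initial_queue.

(** * Averaging over the stationary initial queue *)

Theorem theorem2 (R : realType) (Delta : R) (hDelta : 0 < Delta) :
  exists (C : R) (t0 : nat), 0 < C /\
  forall (K : nat) (lam : R) (mu : 'I_K -> R) (kstar : 'I_K) (pi : nat -> R),
    (2 <= K)%N ->
    0 <= lam ->
    (forall k, 0 <= mu k <= 1) ->
    (forall k, k != kstar -> mu k < mu kstar) ->
    lam < mu kstar ->
    gap mu kstar = Delta ->
    genie_stationary lam (mu kstar) pi ->
    let eps := mu kstar - lam in
    forall t : nat, (t0 < t)%N ->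
      2 / eps <= wfun Delta t / ln (t%:R : R) ->
      expR (6 / Delta ^+ 2) <= t%:R ->
      vfun K eps Delta t + v'fun K eps Delta t <= t%:R / 2 ->
      queue_regret lam mu kstar pi t
        <= C * (K%:R * vfun K eps Delta t * (ln (t%:R : R)) ^+ 2 / t%:R).
Proof.
(* Since service rates lie in [0, 1], a gap above 1 is impossible and any constants will do. *)
have [D1|D1] := leP Delta 1; last first.
  exists 1, 0%N; split => // K lam mu kstar pi K2 lam0 mu01 _ _ gapE.
  suff : Delta <= 1 by rewrite leNgt D1.
  rewrite -gapE /gap; have /andP[_ m1] := mu01 kstar.
  suff : 0 <= \big[maxr/0]_(k < K | k != kstar) mu k by lra.
  exact: bigmax_ge_id.
pose M := 6 / (Delta / 8) ^+ 2.
have D8 : 0 < (Delta / 8) ^+ 2 by rewrite exprn_gt0//; lra.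
have MD : M * (Delta / 8) ^+ 2 = 6 by rewrite /M divfK// gt_eqF.
have M0 : 0 <= M by rewrite /M divr_ge0// ltW.
clearbody M.
have P0 : 0 <= 2 * M + 12 by lra.
have D01 : 0 < Delta <= 1 by rewrite hDelta.
have [t0 asym] := wfun_asymptotics D01 P0.
(* 16 comes from [Ev_regret_bound]; one more unit absorbs its [3 / t] and the [1 / t] due to long
   initial queues. *)
exists 17, t0; split => // K lam mu kstar pi K2 lam0 mu01 _ ltl gapE stat eps.
move=> t /asym[L100 wL Pw lnw Pl] wl _ vt.
have gapD k : k != kstar -> mu k <= mu kstar - Delta.
  move=> kk; suff : mu k <= \big[maxr/0]_(k < K | k != kstar) mu k.
    by rewrite -gapE /gap; lra.
  exact: le_bigmax_cond.
have /andP[mus0 mus1] := mu01 kstar.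
have lam01 : 0 <= lam <= 1 by rewrite lam0; lra.
set L := ln (t%:R : R) in L100 wL Pw Pl wl *; set w := wfun Delta t in wL Pw lnw Pl wl *.
have e0 : 0 < eps by rewrite /eps; lra.
have e1 : eps <= 1 by rewrite /eps; lra.
have L0 : 0 < L by lra.
have T1 : 1 < t%:R :> R by rewrite ltNge; apply/negP => /ln_le0; rewrite -/L; lra.
have T0 : 0 < t%:R :> R by lra.
have w0 : 0 < w by exact: expR_gt0.
have Lew : 2 * L <= eps * w.
  by move: wl; rewrite ler_pdivrMr// mulrAC ler_pdivlMr// [leRHS]mulrC.
have v0v : 24 / eps ^+ 2 * L <= vfun K eps Delta t.
  have e0' := ltW e0; rewrite /vfun lerDl; apply: mulr_ge0.
    by rewrite divr_ge0// mulr_ge0.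
  rewrite divr_ge0// mulr_ge0 ?sqr_ge0// mulr_ge0//; last exact: ltW.
  by rewrite divr_ge0// mulr_ge0.
have vt' : 24 / eps ^+ 2 * L + 6 * K%:R / eps * w <= t%:R / 2.
  by apply: le_trans vt; rewrite lerD2r.
set d := fun q0 : nat => Ev lam mu t
  (fun h => (queue q0 h)%:R - (genie_queue kstar q0 h)%:R).
pose v0 := 24 / eps ^+ 2 * L.
pose B := 16 * (K%:R * v0 * L ^+ 2 / t%:R) + 3 / t%:R.
have dB q0 : q0%:R <= 2 * L / eps -> d q0 <= B.
  by move=> q0L; exact: (@Ev_regret_bound R K lam mu kstar Delta M w).
have dt q0 : d q0 <= t%:R by exact: Ev_regret_trivial.
have v0L : 24 <= v0.
  rewrite /v0 mulrAC ler_pdivlMr ?exprn_gt0//.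
  apply: (@le_trans _ _ (24 * 1)); last by lra.
  by rewrite ler_wpM2l// exprn_ile1// ltW.
have KR : 2 <= K%:R :> R by rewrite (ler_nat _ 2).
have y1 : 4 / t%:R <= K%:R * v0 * L ^+ 2 / t%:R.
  rewrite ler_wpM2r ?invr_ge0 ?(ltW T0)//.
  apply: (@le_trans _ _ (2 * 24 * 1)); first by lra.
  apply: ler_pM => //; first by apply: ler_pM.
  by rewrite exprn_ege1//; lra.
have y0 : 0 <= 4 / t%:R :> R by rewrite divr_ge0// ltW.
have B0 : 0 <= B by rewrite /B; lra.
have tT : 0 <= t%:R^-1 :> R by rewrite invr_ge0 ltW.
apply: (@le_trans _ _ (B + t%:R^-1)); last first.
  apply: (@le_trans _ _ (17 * (K%:R * v0 * L ^+ 2 / t%:R))).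
    rewrite /B; lra.
  rewrite ler_wpM2l// ler_wpM2r// ler_wpM2r ?sqr_ge0// ler_wpM2l//.
have pi0 n : 0 <= pi n by case: stat => + _; apply.
(* Initial queues from [q1] on have stationary mass at most [exp (- 2 L) = t ^ -2]; with the trivial
   bound [t] they contribute at most [1 / t]. *)
pose q1 := (Num.truncn (2 * L / eps)).+1.
have Le0 : 0 <= 2 * L / eps by rewrite divr_ge0 ?(ltW e0)// mulr_ge0// ltW.
have /andP[q1l q1u] := truncn_itv Le0.
have partial n : series (fun q0 => pi q0 * d q0) n <= B + t%:R^-1.
  rewrite /series /=.
  apply: (@le_trans _ _ (\sum_(0 <= q < n) (pi q * B + (q1 <= q)%N%:R * (pi q * t%:R)))).
    apply: ler_sum_nat => q _; have [qq|qq] := leqP q1 q.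
      rewrite mul1r -mulrDr ler_wpM2l//.
      by apply: le_trans (dt q) _; rewrite lerDr.
    rewrite mul0r addr0 ler_wpM2l// dB//.
    by apply: le_trans q1l; rewrite ler_nat -ltnS.
  rewrite big_split /= -mulr_suml; apply: lerD.
    by rewrite ler_piMl// (stationary_mass stat).
  have -> : \sum_(0 <= i < n) (q1 <= i)%N%:R * (pi i * t%:R) =
      (\sum_(q1 <= i < n) pi i) * t%:R.
    rewrite mulr_suml (big_nat_widenl q1 0)//= [RHS]big_mkcond.
    by apply: eq_bigr => i _; case: ifP; rewrite ?mul1r ?mul0r.
  apply: (@le_trans _ _ (expR (- (2 * L)) * t%:R)).
    rewrite ler_wpM2r ?(ltW T0)//.
    apply: le_trans (stationary_tail lam0 mus1 ltl stat q1 n) _.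
    rewrite ler_expR mulNr lerN2 -/eps.
    have := ltW q1u; rewrite ler_pdivrMr//; rewrite -/q1; lra.
  have -> : t%:R^-1 = expR (- L) by rewrite expRN /L lnK.
  rewrite -[X in _ * X](lnK (x := t%:R)) ?posrE// -/L -expRD ler_expR; lra.
rewrite /queue_regret -/(d _).
(* [limn] is 0 when the series diverges, so convergence is not needed. *)
have [cv|ncv] := pselect (cvgn (series (fun q0 => pi q0 * d q0))).
  by apply: limr_le => //; exact: nearW.
by rewrite (dvgP ncv) addr_ge0.
Qed.
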